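(* For every $\varepsilon>0$ there are $\delta>0$ and $d_0$ such that if $d\ge d_0$, $\lambda\ge (1/\sqrt{2}-\delta)^d$, and $S\subseteq\mathbb{R}^d$ is any bounded measurable set with positive Lebesgue measure, then $$\alpha_S(\lambda)\geq(\log\sqrt{2}-\varepsilon)\cdot d\cdot 2^{-d}.$$
   Context: Let $r_d$ be the radius of a ball of volume $1$ in $\mathbb R^d$, and $\mathrm{vol}$ the Lebesgue measure. For a bounded measurable $S\subseteq\mathbb R^d$ of positive measure and $\lambda>0$, the hard sphere model on $S$ at fugacity $\lambda$ is the random finite set $X\subseteq S$ obtained from a Poisson point process on $S$ of intensity $\lambda$ (with respect to Lebesgue measure) conditioned on the event that every two distinct points of $X$ are at Euclidean distance at least $2r_d$. The expected packing density is $\alpha_S(\lambda)=\mathbb E[|X|]/\mathrm{vol}(S)$. Logarithms are natural. *)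

(* Defs.v *)
From HB Require Import structures.
From mathcomp Require Import all_boot all_order all_algebra finmap.
From mathcomp Require Import all_classical all_reals all_analysis.

Set Implicit Arguments.
Unset Strict Implicit.
Unset Printing Implicit Defensive.

Import Order.TTheory GRing.Theory Num.Theory.
Import numFieldNormedType.Exports.

Local Open Scope classical_set_scope.
Local Open Scope ring_scope.

(* R^d is d.-tuple R, whose canonical sigma-algebra is the Borel (product)
   one. *)

Section lebesgue.
Context {R : realType}.

Definition tcons d (p : R * d.-tuple R) : d.+1.-tuple R :=
  [tuple of p.1 :: p.2].

Definition cons_lebesgue d (m : set (d.-tuple R) -> \bar R) :
    set (d.+1.-tuple R) -> \bar R :=
  pushforward (lebesgue_measure \x m)%E (@tcons d).

(* The d-fold product of the one-dimensional Lebesgue measure. *)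
Fixpoint borel_lebesgue d : set (d.-tuple R) -> \bar R :=
  match d with
  | 0 => dirac [tuple]
  | d'.+1 => cons_lebesgue (@borel_lebesgue d')
  end.

Lemma measurable_tcons d : measurable_fun [set: R * d.-tuple R] (@tcons d).
Proof. exact: (@measurable_cons _ _ _ _ fst d snd). Qed.

Section cons_lebesgue_measure.
Context d (m : {sigma_finite_measure set (d.-tuple R) -> \bar R}).

Local Notation nu := (cons_lebesgue m).

Let mpre A : measurable A -> measurable (@tcons d @^-1` A).
Proof.
by move=> mA; rewrite -[X in measurable X]setTI; exact: measurable_tcons.
Qed.

Let nu0 : nu set0 = 0%E.
Proof. by rewrite /cons_lebesgue /pushforward preimage_set0 measure0. Qed.

Let nu_ge0 A : (0 <= nu A)%E.
Proof.
by rewrite /cons_lebesgue /pushforward; apply: (measure_ge0 (_ \x m)%E).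
Qed.

Let nu_sigma_additive : semi_sigma_additive nu.
Proof.
move=> F mF tF mUF; rewrite /cons_lebesgue /pushforward preimage_bigcup.
apply: measure_semi_sigma_additive.
- by move=> n; exact: mpre.
- apply/trivIsetP => /= i j _ _ ij; rewrite -preimage_setI.
  by move/trivIsetP : tF => /(_ _ _ _ _ ij) ->//; rewrite preimage_set0.
- by rewrite -preimage_bigcup; exact: mpre.
Qed.

HB.instance Definition _ := isMeasure.Build _ _ _ nu nu0 nu_ge0 nu_sigma_additive.

Let nu_sigma_finite : sigma_finite setT nu.
Proof.
have /sigma_finiteP[F [TF ndF Foo]] := sigma_finiteT (@lebesgue_measure R).
have /sigma_finiteP[G [TG ndG Goo]] := sigma_finiteT m.
pose u (t : d.+1.-tuple R) : R * d.-tuple R := (thead t, [tuple of behead t]).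
have mu : measurable_fun setT u.
  by apply/measurable_fun_pair; [exact: measurable_tnth|exact: measurable_behead].
have tconsK : cancel (@tcons d) u.
  by move=> [x t]; congr pair; apply: val_inj.
exists (fun n => u @^-1` (F n `*` G n)).
  apply/esym; rewrite -subTset => t _.
  have [n _ Fn] : (\bigcup_n F n) (u t).1 by rewrite -TF.
  have [k _ Gk] : (\bigcup_n G n) (u t).2 by rewrite -TG.
  exists (maxn n k) => //; split.
  - by move: (u t).1 Fn; exact/subsetPset/ndF/leq_maxl.
  - by move: (u t).2 Gk; exact/subsetPset/ndG/leq_maxr.
move=> n; have [mF Fy] := Foo n; have [mG Gy] := Goo n; split.
  by rewrite -[X in measurable X]setTI; apply: mu => //; exact: measurableX.
rewrite /cons_lebesgue /pushforward -comp_preimage (_ : u \o _ = id); last first.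
  by apply/funext => x /=; rewrite tconsK.
by rewrite preimage_id product_measure1E// lte_mul_pinfty// ge0_fin_numE.
Qed.

HB.instance Definition _ := Measure_isSigmaFinite.Build _ _ _ nu nu_sigma_finite.

End cons_lebesgue_measure.

Lemma borel_lebesgueP d :
  exists m : {sigma_finite_measure set (d.-tuple R) -> \bar R},
    @borel_lebesgue d = m.
Proof.
elim: d => [|d [m mE]]; first by exists (dirac [tuple]).
by exists (cons_lebesgue m); rewrite /= mE.
Qed.

Section borel_lebesgue_measure.
Variable d : nat.

Let bl0 : @borel_lebesgue d set0 = 0%E.
Proof. by have [m ->] := borel_lebesgueP d; rewrite measure0. Qed.

Let bl_ge0 A : (0 <= @borel_lebesgue d A)%E.
Proof. by have [m ->] := borel_lebesgueP d. Qed.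

Let bl_sigma_additive : semi_sigma_additive (@borel_lebesgue d).
Proof.
have [m ->] := borel_lebesgueP d; exact: measure_semi_sigma_additive.
Qed.

HB.instance Definition _ := isMeasure.Build _ _ _ (@borel_lebesgue d)
  bl0 bl_ge0 bl_sigma_additive.

Let bl_sigma_finite : sigma_finite setT (@borel_lebesgue d).
Proof. by have [m ->] := borel_lebesgueP d; exact: sigma_finiteT. Qed.

HB.instance Definition _ := Measure_isSigmaFinite.Build _ _ _
  (@borel_lebesgue d) bl_sigma_finite.

End borel_lebesgue_measure.

(* Lebesgue measure on R^d and Lebesgue measurable sets: the completion of
   borel_lebesgue. *)
Definition vol d : set (d.-tuple R) -> \bar R :=
  @completed_measure_extension _ _ _ (@borel_lebesgue d).

Definition lebesgue_measurable d (A : set (d.-tuple R)) : Prop :=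
  (@borel_lebesgue d)^*%mu.-cara.-measurable A.

End lebesgue.

Section euclidean.
Context {R : realType}.

Definition eucl_dist d (x y : d.-tuple R) : R :=
  Num.sqrt (\sum_(i < d) (tnth x i - tnth y i) ^+ 2).

Definition eucl_ball d (c : d.-tuple R) (r : R) : set (d.-tuple R) :=
  [set x | eucl_dist c x <= r].

Definition origin d : d.-tuple R := [tuple 0 | i < d].

Definition eucl_bounded d (A : set (d.-tuple R)) : Prop :=
  exists M : R, A `<=` eucl_ball (origin d) M.

End euclidean.

Definition unit_volume_radius (R : realType) (d : nat) : R :=
  xget 0 [set r : R | 0 < r /\ vol (eucl_ball (origin d) r) = 1%E].

Section hard_spheres.
Context {R : realType} (d : nat).
Local Open Scope fset_scope.

Definition npoints (A : set (d.-tuple R)) (X : {fset d.-tuple R}) : nat :=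
  #|` [fset x in X | x \in A]|.

Context (dd : measure_display) (T : measurableType dd) (P : probability T R).
Implicit Types (X : T -> {fset d.-tuple R}) (S : set (d.-tuple R)).

(* X is a Poisson point process on S of intensity lam with respect to Lebesgue
   measure: its points lie in S, the number of points in a Borel set A is
   Poisson distributed with mean lam * vol (A `&` S), and the numbers of points
   in pairwise disjoint Borel sets are mutually independent. The second argument
   of poisson_prob is a dummy of the library; for rate 0 it is the Dirac measure
   at 0. *)
Definition poisson_process S (lam : R) X : Prop :=
  [/\ forall w x, x \in X w -> S x,
      forall A k, measurable A -> measurable [set w | npoints A (X w) = k],
      forall A (B : set nat), measurable A ->
        P [set w | B (npoints A (X w))] =
        poisson_prob (lam * fine (vol (A `&` S))) 0%N B
    & forall n (A : 'I_n -> set (d.-tuple R)) (B : 'I_n -> set nat),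
        (forall i, measurable (A i)) -> trivIset setT A ->
        P [set w | forall i, B i (npoints (A i) (X w))] =
        (\prod_(i < n) P [set w | B i (npoints (A i) (X w))])%E].

Definition hard_core X : set T :=
  [set w | forall x y, x \in X w -> y \in X w -> x != y ->
     2 * unit_volume_radius R d <= eucl_dist x y].

(* The expectation of f under P conditioned on the event H; here P H > 0. *)
Definition cond_expectation (f : T -> R) (H : set T) : R :=
  fine (\int[P]_(w in H) (f w)%:E) / fine (P H).

(* alpha_S(lam), for X a Poisson point process on S of intensity lam. *)
Definition packing_density S X : R :=
  cond_expectation (fun w => #|` X w|%:R) (hard_core X) / fine (vol S).

End hard_spheres.

(* Main.v *)
(* Cut R^d into tiny cells. The numbers of points in the cells are independent
   Poisson variables, so the hard sphere model becomes, up to a vanishing error,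
   the hard-core model of a finite weighted graph in which two cells are adjacent
   when all their points are at distance less than 2 r_d.

   In such a graph, let I be the random stable set, N(v) the closed neighbourhood
   of a vertex v, and T the part of N(v) not covered by I \ N(v). Given I \ N(v),
   the set I inside N(v) is a hard-core sample on T, so that
   P(I misses N(v)) = E[1 / Z_T] with Z_T <= exp (lam vol T). Either lam vol T < K
   with noticeable probability, which makes E|I| = lam sum_v P(I misses N(v))
   large, or lam vol T >= K, and then T contains about K points on average as soon
   as few pairs of points of T are at distance less than 2 r_d; averaging over v
   and using vol N(v) <= 2^d bounds E|I| from below again. One takes K just below
   d log (sqrt 2).

   It remains to see that a set T of volume at least (sqrt 2 (1 + theta))^d has an
   exponentially small proportion p of close pairs. By Sidorenko's inequality the
   complete bipartite graph K_{m,m} has density at least p^(m^2) in the graph of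
   close pairs, while Gaussian integration bounds the volume of the
   configurations x_1, ..., x_m, y_1, ..., y_m with all |x_i - y_j| < 2 r_d by
   about vol T * 2^(d m); for m large this forces p to be exponentially small. *)
From HB Require Import structures.
Require Import Defs.
From mathcomp Require Import all_boot all_order all_algebra finmap.
From mathcomp Require Import all_classical all_reals all_analysis.
From mathcomp Require Import measurable_realfun ring lra.

Set Implicit Arguments.
Unset Strict Implicit.
Unset Printing Implicit Defensive.

Import Order.TTheory GRing.Theory Num.Theory.
Import numFieldNormedType.Exports.

Local Open Scope ring_scope.

(** * The hard-core model on a finite weighted graph *)

Section hard_core_model.
Context {R : realType} {V : finType}.
Variables (e : rel V) (mu : V -> R).
Hypotheses (e_refl : reflexive e) (e_sym : symmetric e).
Hypothesis mu_ge0 : forall v, 0 <= mu v.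
Implicit Types (I J T B : {set V}) (l : R).

Definition stable I := [forall x in I, forall y in I, e x y ==> (x == y)].

Definition nbhd v : {set V} := [set u | e v u]%SET.

Definition mass T := \sum_(v in T) mu v.

Definition weight l I := \prod_(i in I) (l * mu i).

Definition partition_fun l T := \sum_(I : {set V} | (I \subset T) && stable I) weight l I.

(** Not normalised: the mean size of a random stable subset of T is the quotient of [occupation] by
    [partition_fun]. *)
Definition occupation l T :=
  \sum_(I : {set V} | (I \subset T) && stable I) #|I|%:R * weight l I.

Definition uncovered B J : {set V} := [set u in B | [forall x in J, ~~ e x u]]%SET.

Local Notation Z := partition_fun.
Local Notation N := occupation.

Lemma stableP I : reflect {in I &, forall x y, e x y -> x = y} (stable I).
Proof.
apply: (iffP forall_inP) => [h x y xI yI exy|h x xI].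
  by have /forall_inP/(_ y yI)/implyP/(_ exy)/eqP := h x xI.
by apply/forall_inP => y yI; apply/implyP => exy; apply/eqP/h.
Qed.

Lemma stableS I J : I \subset J -> stable J -> stable I.
Proof.
by move=> /fintype.subsetP IJ /stableP sJ; apply/stableP => x y /IJ xJ /IJ yJ; exact: sJ.
Qed.

Lemma stable0 : stable finset.set0.
Proof. by apply/stableP => x y; rewrite inE. Qed.

Lemma weight_ge0 l I : 0 <= l -> 0 <= weight l I.
Proof. by move=> l0; apply: prodr_ge0 => i _; rewrite mulr_ge0. Qed.

Lemma weightE l I : weight l I = l ^+ #|I| * weight 1 I.
Proof.
rewrite /weight big_split/= prodr_const; congr (_ * _).
by apply: eq_bigr => i _; rewrite mul1r.
Qed.

Lemma weightU l I J : [disjoint I & J] ->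
  weight l (I :|: J)%SET = weight l I * weight l J.
Proof.
move=> IJ; rewrite /weight (eq_bigl [predU I & J]) ?bigU// => x.
by rewrite !inE.
Qed.

Lemma partition_fun_ge1 l T : 0 <= l -> 1 <= Z l T.
Proof.
move=> l0; rewrite /Z (bigD1 finset.set0) ?finset.sub0set ?stable0//=.
by rewrite /weight finset.big_set0 lerDl sumr_ge0// => I _; exact: weight_ge0.
Qed.

Lemma partition_fun_ge0 l T : 0 <= l -> 0 <= Z l T.
Proof. by move=> l0; apply: le_trans (partition_fun_ge1 T l0). Qed.

Lemma occupation_ge0 l T : 0 <= l -> 0 <= N l T.
Proof. by move=> l0; apply: sumr_ge0 => I _; rewrite mulr_ge0 ?weight_ge0. Qed.

Lemma partition_funS l T T' : 0 <= l -> T \subset T' -> Z l T <= Z l T'.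
Proof.
move=> l0 TT'; rewrite [leRHS](bigID (fun I => I \subset T))/=.
rewrite -[leLHS]addr0 lerD ?sumr_ge0//; last by move=> *; exact: weight_ge0.
rewrite le_eqVlt (eq_bigl (fun I => (I \subset T) && stable I)) ?eqxx// => I.
case: (boolP (I \subset T)) => [IT|]; last by rewrite andbF.
by rewrite (fintype.subset_trans IT TT') !andbT.
Qed.

(** Without the stability condition the sum runs over all subsets of T and factors as the product of
    the 1 + l mu_i. *)
Lemma partition_fun_le_expR l T : 0 <= l -> Z l T <= expR (l * mass T).
Proof.
move=> l0.
apply: (@le_trans _ _ (\sum_(I : {set V} | I \subset T) weight l I)).
  rewrite [leRHS](bigID stable)/= lerDl sumr_ge0// => *; exact: weight_ge0.
have -> : \sum_(I : {set V} | I \subset T) weight l I = \prod_(i in T) (l * mu i + 1).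
  rewrite [RHS]big_mkcond/=.
  (* A factor 0 outside T kills the subsets not contained in T when the product over all vertices is
     expanded. *)
  transitivity (\prod_i ((if i \in T then l * mu i else 0) + 1)); last first.
    by apply: eq_bigr => i _; case: ifP => // _; rewrite add0r.
  rewrite bigA_distr [RHS](bigID (fun I => I \subset T))/= [X in _ = _ + X]big1.
    rewrite addr0; apply: eq_bigr => I IT; rewrite /weight.
    rewrite [LHS]big_mkcond/=; apply: eq_bigr => i _.
    by case: ifP => // /(fintype.subsetP IT) ->.
  move=> I /fintype.subsetPn[x xI xT]; rewrite (bigD1 x)//= xI (negbTE xT) mul0r//.
rewrite mulr_sumr expR_sum ler_prod// => i _.
by rewrite addr_ge0 ?mulr_ge0//= addrC expR_ge1Dx.
Qed.

(** Spatial Markov property: given J = I \ B, the rest of I ranges exactly over the stable subsets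
    of the part of B that J leaves uncovered, and the weights multiply. *)
Lemma partition_fun_cond l (W B : {set V}) (f : {set V} -> R) :
  \sum_(I : {set V} | (I \subset W) && stable I) f (I :&: B)%SET * weight l I =
  \sum_(J : {set V} | (J \subset W :\: B) && stable J)
    weight l J *
    \sum_(I : {set V} | (I \subset uncovered (W :&: B) J) && stable I) f I * weight l I.
Proof.
under [RHS]eq_bigr do rewrite mulr_sumr.
rewrite pair_big_dep/=.
rewrite (reindex (fun I => ((I :\: B)%SET, (I :&: B)%SET)))/=; last first.
  exists (fun p => (p.1 :|: p.2)%SET) => [I _|[J I]] /=.
    by rewrite finset.setUC finset.setID.
  rewrite inE/= => /andP[/andP[JW sJ] /andP[IU sI]].
  have JB : [disjoint J & B].
    by move: JW; rewrite finset.subsetD => /andP[].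
  have IB : I \subset B.
    by apply/fintype.subsetP => x /(fintype.subsetP IU); rewrite !inE => /andP[/andP[]].
  congr pair; apply/finset.setP => x; rewrite !inE.
    case: (boolP (x \in J)) => xJ /=; last first.
      by case: (boolP (x \in I)) => xI; rewrite ?andbF//= (fintype.subsetP IB)//.
    by rewrite (disjointFr JB xJ).
  case: (boolP (x \in I)) => xI /=; first by rewrite orbT (fintype.subsetP IB).
  by case: (boolP (x \in J)) => xJ//=; rewrite (disjointFr JB xJ).
apply: eq_big => [I|I /andP[IW sI]]; last first.
  rewrite mulrCA; congr (_ * _); rewrite -weightU; last first.
    rewrite -finset.setI_eq0; apply/eqP/finset.setP => x; rewrite !inE.
    by case: (x \in B); rewrite !(andbT, andbF).
  by congr weight; rewrite finset.setUC finset.setID.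
apply/andP/andP => [[IW sI]|[/andP[IW sI] /andP[IU sIB]]].
  split; apply/andP; split.
  - exact: finset.setSD.
  - by apply: stableS sI; exact: finset.subsetDl.
  - apply/fintype.subsetP => x; rewrite !inE => /andP[xI xB]; rewrite xB (fintype.subsetP IW)//=.
    apply/forall_inP => y; rewrite !inE => /andP[yB yI]; apply/negP => eyx.
    by move/stableP : sI => /(_ y x yI xI eyx) yx; rewrite yx xB in yB.
  - by apply: stableS sI; exact: finset.subsetIl.
(* An uncovered vertex has no neighbour in I \ B, so no edge joins the two halves of I. *)
have cross x y : x \in I -> y \in I -> x \in B -> y \notin B -> ~~ e y x.
  move=> xI yI xB yB; have /(fintype.subsetP IU) : x \in (I :&: B)%SET by rewrite inE xI.
  by rewrite !inE => /andP[_ /forall_inP]; apply; rewrite !inE yB.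
split.
  apply/fintype.subsetP => x xI; case: (boolP (x \in B)) => xB.
    have /(fintype.subsetP IU) : x \in (I :&: B)%SET by rewrite inE xI.
    by rewrite !inE => /andP[/andP[]].
  have /(fintype.subsetP IW) : x \in (I :\: B)%SET by rewrite inE xI xB.
  by rewrite !inE => /andP[].
apply/stableP => x y xI yI exy.
case: (boolP (x \in B)) (boolP (y \in B)) => xB [] yB.
- by move/stableP : sIB; apply => //; rewrite !inE ?xI ?yI.
- by move: (cross _ _ xI yI xB yB); rewrite e_sym exy.
- by move: (cross _ _ yI xI yB xB); rewrite exy.
- by move/stableP : sI; apply => //; rewrite !inE ?xB ?yB.
Qed.

(** Conditioning with f = 1: forgetting what J covers only enlarges the inner partition function. *)
Lemma partition_fun_le_setID l T B : 0 <= l ->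
  Z l T <= Z l (T :&: B) * Z l (T :\: B).
Proof.
move=> l0; have := partition_fun_cond l T B (fun=> 1).
under eq_bigr do rewrite mul1r; rewrite -/(Z l T) => ->.
rewrite [leRHS]mulrC [leRHS]mulr_suml; apply: ler_sum => J _.
rewrite ler_wpM2l ?weight_ge0//.
under eq_bigr do rewrite mul1r.
apply: partition_funS => //; apply/fintype.subsetP => x.
by rewrite !inE => /andP[].
Qed.

(** Double counting of the pairs u in I: removing u from I leaves an arbitrary stable subset of T \
    N(u), as N(u) contains u. *)
Lemma occupationE l T :
  N l T = l * \sum_(u in T) mu u * Z l (T :\: nbhd u).
Proof.
rewrite /N; transitivity (\sum_(I : {set V} | (I \subset T) && stable I)
    \sum_(u in T | u \in I) weight l I).
  apply: eq_bigr => I /andP[IT _]; rewrite -sum1_card natr_sum mulr_suml.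
  rewrite [RHS](eq_bigl (fun u => u \in I)) => [|u].
    by apply: eq_bigr => u _; rewrite mul1r.
  by case: (boolP (u \in I)) => uI; rewrite ?andbF// (fintype.subsetP IT).
rewrite (exchange_big_dep (fun u => u \in T))/=; last by move=> ? ? _ /andP[].
rewrite mulr_sumr; apply: eq_bigr => u uT; rewrite mulrA mulr_sumr.
rewrite (reindex_onto (fun J => (u |: J)%SET) (fun I => (I :\ u)%SET))/=; last first.
  by move=> I /andP[_ /andP[_ uI]]; rewrite finset.setD1K.
apply: eq_big => [J|J /andP[/andP[_ _] /eqP uJ]]; last first.
  rewrite /weight finset.big_setU1//=.
  by move/finset.setP : uJ => /(_ u); rewrite !inE eqxx/= => /esym/negbT.
rewrite uT finset.setU11 !andbT/=.
apply/andP/andP => [[/andP[uJT /stableP suJ] /eqP uJ]|[JT /stableP sJ]].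
  have uNJ : u \notin J.
    by move/finset.setP : uJ => /(_ u); rewrite !inE eqxx/= => /esym/negbT.
  split; last by apply: (@stableS _ (u |: J)%SET (finset.subsetUr _ _)); exact/stableP.
  apply/fintype.subsetP => x xJ; rewrite !inE (fintype.subsetP uJT) ?inE ?xJ ?orbT// andbT.
  apply/negP => eux; have ux := suJ u x; rewrite !inE eqxx xJ orbT in ux.
  by rewrite (ux isT isT eux) xJ in uNJ.
have uNJ : u \notin J.
  by apply/negP => /(fintype.subsetP JT); rewrite !inE e_refl.
split; last by rewrite finset.setU1K.
apply/andP; split.
  rewrite finset.subUset finset.sub1set uT/=; apply: fintype.subset_trans JT _.
  exact: finset.subsetDl.
have nJ x : x \in J -> ~~ e u x by move/(fintype.subsetP JT); rewrite !inE => /andP[].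
apply/stableP => x y; rewrite !inE => /orP[/eqP->|xJ] /orP[/eqP->|yJ]//.
- by move=> euy; move: (nJ y yJ); rewrite euy.
- by move=> exu; move: (nJ x xJ); rewrite e_sym exu.
- exact: sJ.
Qed.

(** The mean size N / Z grows with the fugacity. The cross-multiplied difference is a double sum
    over (I, J); once symmetrised, its terms are nonnegative because #|I| - #|J| and l^#|I| l'^#|J|
    - l'^#|I| l^#|J| have the same sign. *)
Lemma occupation_mono l l' T : 0 <= l' -> l' <= l ->
  N l' T * Z l T <= N l T * Z l' T.
Proof.
move=> l'0 ll'; have l0 : 0 <= l by exact: le_trans ll'.
rewrite -subr_ge0.
pose F I J := #|I|%:R * (l ^+ #|I| * l' ^+ #|J| - l' ^+ #|I| * l ^+ #|J|) *
  (weight 1 I * weight 1 J).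
have -> : N l T * Z l' T - N l' T * Z l T =
    \sum_(I : {set V} | (I \subset T) && stable I)
    \sum_(J : {set V} | (J \subset T) && stable J) F I J.
  rewrite /N /Z !mulr_suml -sumrB; apply: eq_bigr => I _.
  rewrite !mulr_sumr -sumrB; apply: eq_bigr => J _.
  rewrite (weightE l I) (weightE l' I) (weightE l J) (weightE l' J) /F; ring.
set S := (X in 0 <= X).
suff : 0 <= S + S by lra.
rewrite {2}/S exchange_big/= -big_split/=; apply: sumr_ge0 => I _.
rewrite -big_split/=; apply: sumr_ge0 => J _.
rewrite /F.
have -> : #|I|%:R * (l ^+ #|I| * l' ^+ #|J| - l' ^+ #|I| * l ^+ #|J|) *
   (weight 1 I * weight 1 J) +
   #|J|%:R * (l ^+ #|J| * l' ^+ #|I| - l' ^+ #|J| * l ^+ #|I|) *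
   (weight 1 J * weight 1 I) =
   ((#|I|%:R - #|J|%:R) * (l ^+ #|I| * l' ^+ #|J| - l' ^+ #|I| * l ^+ #|J|)) *
   (weight 1 I * weight 1 J) by ring.
apply: mulr_ge0; last by rewrite mulr_ge0 ?weight_ge0.
wlog IJ : I J / (#|I| <= #|J|)%N => [h|].
  have [|/ltnW] := leqP #|I| #|J|; first exact: h.
  move=> /h.
  congr (0 <= _); ring.
rewrite -(subnKC IJ) !exprD natrD.
set m := (#|J| - #|I|)%N.
have -> : (#|I|%:R - (#|I|%:R + m%:R)) *
  (l ^+ #|I| * (l' ^+ #|I| * l' ^+ m) - l' ^+ #|I| * (l ^+ #|I| * l ^+ m)) =
  m%:R * (l ^+ #|I| * l' ^+ #|I|) * (l ^+ m - l' ^+ m) :> R by ring.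
rewrite mulr_ge0//; first by rewrite mulr_ge0// mulr_ge0// exprn_ge0.
by rewrite subr_ge0 lerXn2r.
Qed.

(** In [occupationE], the ratio of the partition functions of T \ N(u) and T is at least 1 over that
    of T :&: N(u), hence at least exp (- x) >= 1 - x with x = l mass (T :&: N(u)). *)
Lemma occupation_lower_bound l T p : 0 <= l ->
  \sum_(u in T) mu u * mass (T :&: nbhd u) <= p * mass T ^+ 2 ->
  l * mass T * (1 - p * (l * mass T)) * Z l T <= N l T.
Proof.
move=> l0 hp; rewrite occupationE.
apply: (@le_trans _ _ (l * \sum_(u in T) mu u *
    ((1 - l * mass (T :&: nbhd u)) * Z l T))); last first.
  rewrite ler_wpM2l// ler_sum// => u uT; rewrite ler_wpM2l//.
  have h := partition_fun_le_setID T (nbhd u) l0.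
  have hE := partition_fun_le_expR (T :&: nbhd u) l0.
  set x := l * mass _ in hE *.
  have z0 : 0 <= Z l (T :\: nbhd u) by exact: partition_fun_ge0.
  apply: (@le_trans _ _ (expR (- x) * Z l T)).
    by rewrite ler_wpM2r ?partition_fun_ge0// expR_ge1Dx.
  rewrite expRN ler_pdivrMl ?expR_gt0//; apply: le_trans h _.
  by rewrite ler_wpM2r.
have -> : \sum_(u in T) mu u * ((1 - l * mass (T :&: nbhd u)) * Z l T) =
   (mass T - l * \sum_(u in T) mu u * mass (T :&: nbhd u)) * Z l T.
  rewrite /mass mulr_sumr -sumrB mulr_suml; apply: eq_bigr => u _; ring.
rewrite [leRHS]mulrA ler_wpM2r ?partition_fun_ge0// -mulrA ler_wpM2l//.
have := ler_wpM2l l0 hp; lra.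
Qed.

(** Let T be the uncovered part of N(v). If l mass T reaches K, then T holds at least K' points on
    average; otherwise T is empty with conditional probability at least exp (- K). Both
    contributions are added and averaged over v with weights mu v. *)
Lemma occupation_density (D l K K' : R) : 0 < l -> 0 <= K' ->
  (forall v, mass (nbhd v) <= D) ->
  (forall v T, T \subset nbhd v -> K <= l * mass T -> K' * Z l T <= N l T) ->
  K' * mass [set: V] * Z l [set: V] <=
    (D + K' * expR K / l) * N l [set: V].
Proof.
move=> l_gt0 K'0 hD hT; have l0 := ltW l_gt0.
(* [c v] is Z times the mean number of points in N(v). *)
pose c v := \sum_(I : {set V} | (I \subset finset.setT) && stable I)
  #|I :&: nbhd v|%:R * weight l I.
(* The last partition function is Z times the probability that I misses N(v). *)
have cond v : K' * Z l [set: V] <=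
    c v + K' * expR K * Z l ([set: V] :\: nbhd v).
  have -> : Z l [set: V] =
      \sum_(J : {set V} | (J \subset finset.setT :\: nbhd v) && stable J)
      weight l J * Z l (uncovered (nbhd v) J).
    have := partition_fun_cond l finset.setT (nbhd v) (fun=> 1).
    under eq_bigr do rewrite mul1r; rewrite -/(Z l _) => ->.
    rewrite finset.setTI; apply: eq_bigr => J _; congr (_ * _).
    by apply: eq_bigr => *; rewrite mul1r.
  rewrite /c (partition_fun_cond l finset.setT (nbhd v) (fun I => #|I|%:R)).
  rewrite finset.setTI /Z !mulr_sumr -big_split/=; apply: ler_sum => J _.
  rewrite -/(Z l _) -/(N l _) mulrCA [X in _ <= _ + X]mulrC -mulrDr.
  rewrite ler_wpM2l ?weight_ge0//.
  set T := uncovered _ _.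
  have [KT|KT] := leP K (l * mass T).
    apply: (le_trans (hT v T _ KT)); last by rewrite lerDl mulr_ge0 ?expR_ge0.
    by apply/fintype.subsetP => x; rewrite inE => /andP[].
  apply: (@le_trans _ _ (K' * expR K)); last by rewrite lerDr occupation_ge0.
  rewrite ler_wpM2l//; apply: le_trans (partition_fun_le_expR T l0) _.
  by rewrite ler_expR ltW.
(* A vertex u of I lies in N(v) exactly when v is in N(u), and N(u) has mass at most D. *)
have sumc : \sum_v mu v * c v <= D * N l [set: V].
  rewrite /N mulr_sumr.
  have -> : \sum_v mu v * c v = \sum_(I : {set V} | (I \subset finset.setT) && stable I)
     weight l I * \sum_v mu v * #|I :&: nbhd v|%:R.
    rewrite /c; under eq_bigr do rewrite mulr_sumr.
    rewrite exchange_big/=; apply: eq_bigr => I _; rewrite mulr_sumr.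
    by apply: eq_bigr => v _; ring.
  apply: ler_sum => I _; rewrite mulrA [leRHS]mulrC.
  rewrite ler_wpM2l ?weight_ge0//.
  have -> : \sum_v mu v * #|I :&: nbhd v|%:R = \sum_(u in I) mass (nbhd u).
    rewrite /mass (exchange_big_dep predT)//=; apply: eq_bigr => v _.
    rewrite -sum1_card natr_sum mulr_sumr; apply: eq_big => [u|u _]; last by rewrite mulr1.
    by rewrite !inE e_sym.
  rewrite mulrC mulr_natl -sumr_const; exact: ler_sum.
have NE := occupationE l [set: V].
have -> : (D + K' * expR K / l) * N l [set: V] =
    D * N l [set: V] + K' * expR K *
      \sum_(u in [set: V]) mu u * Z l ([set: V] :\: nbhd u).
  rewrite mulrDl; congr (_ + _); rewrite {1}NE mulrA; congr (_ * _).
  by rewrite divfK// gt_eqF.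
apply: le_trans (lerD sumc (lexx _)).
rewrite mulrAC /mass [leLHS]mulr_sumr [X in _ + X]mulr_sumr.
rewrite (eq_bigl xpredT) => [|v]; last by rewrite inE.
rewrite [X in _ + X](eq_bigl xpredT) => [|v]; last by rewrite inE.
rewrite -big_split/=; apply: ler_sum => v _.
have := ler_wpM2l (mu_ge0 v) (cond v); lra.
Qed.

End hard_core_model.

(** * Power means and Sidorenko's inequality for complete bipartite graphs *)

Section power_mean.
Context {R : realDomainType}.

(** Chebyshev's sum inequality: x_i and x_i^n are similarly ordered, so the symmetrised difference
    has nonnegative terms. *)
Lemma chebyshev_sum_exprn (V : finType) (a x : V -> R) n :
  (forall i, 0 <= a i) -> (forall i, 0 <= x i) ->
  (\sum_i a i * x i) * (\sum_i a i * x i ^+ n) <=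
  (\sum_i a i) * (\sum_i a i * x i ^+ n.+1).
Proof.
move=> a0 x0; rewrite -subr_ge0.
pose F i j := a i * a j * (x i * (x i ^+ n - x j ^+ n)).
have -> : (\sum_i a i) * (\sum_i a i * x i ^+ n.+1) -
    (\sum_i a i * x i) * (\sum_i a i * x i ^+ n) = \sum_i \sum_j F i j.
  rewrite [(\sum_i a i) * _]mulrC !mulr_suml -sumrB; apply: eq_bigr => i _.
  rewrite !mulr_sumr -sumrB; apply: eq_bigr => j _.
  rewrite /F exprS; ring.
set S := (X in 0 <= X).
suff : 0 <= S + S by lra.
rewrite {2}/S exchange_big/= -big_split/=; apply: sumr_ge0 => i _.
rewrite -big_split/=; apply: sumr_ge0 => j _.
have -> : F i j + F j i = a i * a j * ((x i - x j) * (x i ^+ n - x j ^+ n)).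
  by rewrite /F; ring.
apply: mulr_ge0; first by rewrite mulr_ge0.
have [xij|/ltW xij] := leP (x i) (x j).
  by rewrite mulr_le0 ?subr_le0// lerXn2r ?nnegrE.
by rewrite mulr_ge0 ?subr_ge0// lerXn2r ?nnegrE.
Qed.

Lemma power_mean (V : finType) (a x : V -> R) n :
  (forall i, 0 <= a i) -> (forall i, 0 <= x i) ->
  (\sum_i a i * x i) ^+ n.+1 <= (\sum_i a i) ^+ n * \sum_i a i * x i ^+ n.+1.
Proof.
move=> a0 x0; elim: n => [|n IH].
  by rewrite expr1 expr0 mul1r lexx.
have ax0 : 0 <= \sum_i a i * x i by apply: sumr_ge0 => i _; rewrite mulr_ge0.
rewrite exprS; apply: le_trans (ler_wpM2l ax0 IH) _.
rewrite mulrCA exprSr -mulrA ler_wpM2l//.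
  by rewrite exprn_ge0// sumr_ge0.
exact: chebyshev_sum_exprn.
Qed.

(** The power mean of the degrees counts stars with n+1 leaves. Regrouping the stars by their leaves
    f, a second power mean, now of the common degree of f, counts copies of K_{n+1,n+1}. *)
Lemma sidorenko_complete_bipartite (V : finType) (a : V -> R) (b : V -> V -> R) n :
  (forall i, 0 <= a i) -> (forall i j, 0 <= b i j) ->
  (\sum_j a j * \sum_i a i * b i j) ^+ (n.+1 * n.+1) <=
  (\sum_i a i) ^+ (n * n.+1).*2 *
    \sum_(f : {ffun 'I_n.+1 -> V}) (\prod_l a (f l)) *
      (\sum_j a j * \prod_l b (f l) j) ^+ n.+1.
Proof.
move=> a0 b0; set M := \sum_i a i.
have M0 : 0 <= M by exact: sumr_ge0.
have g0 j : 0 <= \sum_i a i * b i j.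
  by apply: sumr_ge0 => i _; rewrite mulr_ge0.
have step1 := power_mean n a0 g0.
have E : \sum_j a j * (\sum_i a i * b i j) ^+ n.+1 =
    \sum_(f : {ffun 'I_n.+1 -> V}) (\prod_l a (f l)) *
      (\sum_j a j * \prod_l b (f l) j).
  under [RHS]eq_bigr do rewrite mulr_sumr.
  rewrite exchange_big/=; apply: eq_bigr => j _.
  have -> : (\sum_i a i * b i j) ^+ n.+1 =
      \prod_(l < n.+1) \sum_i a i * b i j by rewrite prodr_const card_ord.
  rewrite bigA_distr_bigA mulr_sumr; apply: eq_bigr => f _.
  by rewrite big_split/= mulrCA.
rewrite exprM.
apply: (@le_trans _ _ ((M ^+ n * \sum_j a j * (\sum_i a i * b i j) ^+ n.+1) ^+ n.+1)).
  rewrite lerXn2r ?nnegrE ?exprn_ge0//.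
    by apply: sumr_ge0 => j _; rewrite mulr_ge0.
  by rewrite mulr_ge0 ?exprn_ge0// sumr_ge0// => j _; rewrite mulr_ge0// exprn_ge0.
rewrite exprMn -exprM -addnn exprD -mulrA ler_wpM2l ?exprn_ge0// E.
(* This power of M is the n-th power of the total weight of all f, as needed to apply [power_mean]
   over f. *)
have -> : M ^+ (n * n.+1) = (\sum_(f : {ffun 'I_n.+1 -> V}) \prod_l a (f l)) ^+ n.
  rewrite -(@bigA_distr_bigA _ _ _ _ _ _ _ (fun=> a))/= prodr_const card_ord.
  by rewrite -/M -exprM mulnC.
apply: power_mean => f; first exact: prodr_ge0.
by apply: sumr_ge0 => j _; rewrite mulr_ge0// prodr_ge0.
Qed.

End power_mean.

Local Open Scope classical_set_scope.
Local Open Scope ring_scope.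

(** * Affine substitutions and Gaussian integrals on the line *)

Section affine_change.
Context {R : realType}.
Local Notation leb := (@lebesgue_measure R).

Lemma measurable_affine (a b : R) : measurable_fun setT (fun x : R => a * x + b).
Proof. by apply: measurable_funD => //; exact: measurable_funM. Qed.

(** By uniqueness of Lebesgue measure: a times the pushforward agrees with it on half-open
    intervals. *)
Lemma lebesgue_measure_affine (a b : R) (A : set R) : 0 < a -> measurable A ->
  leb ((fun x => a * x + b) @^-1` A) = (a^-1%:E * leb A)%E.
Proof.
move=> a0 mA.
pose push := @measure_function_pushforward__canonical__measure_function_Measure _ _
  (measurableTypeR R) (measurableTypeR R) R
  leb _ (measurable_affine a b).
suff -> : leb A = mscale (NngNum (ltW a0)) push A.
  by rewrite /mscale/= muleA -EFinM mulVf ?gt_eqF// mul1e.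
apply: (@lebesgue_measure_unique R (mscale (NngNum (ltW a0)) push) _ A mA) => //.
move=> _ [[u v] _ <-].
rewrite -[RHS]/(a%:E * leb ((fun x : R => (a * x + b)%R) @^-1` `]u, v]%classic))%E.
have -> : (fun x => a * x + b) @^-1` `]u, v] = `](u - b) / a, (v - b) / a]%classic.
  by apply/seteqP; split => x/=; rewrite !in_itv/= ltr_pdivrMr// ler_pdivlMr//
    ltrBlDr lerBrDr [x * a]mulrC.
rewrite !lebesgue_measure_itv/= !lte_fin ltr_pM2r ?invr_gt0// ltrD2r.
case: ifPn => _; last by rewrite mule0.
by rewrite -!EFinB -EFinM; congr (_%:E); field; rewrite gt_eqF.
Qed.

Lemma integral_affine (a b : R) (f : R -> \bar R) : 0 < a ->
  measurable_fun setT f -> (forall x, 0 <= f x)%E ->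
  (\int[leb]_x f (a * x + b)%R = a^-1%:E * \int[leb]_x f x)%E.
Proof.
move=> a0 mf f0.
have := @ge0_integral_pushforward _ _ (measurableTypeR R) (measurableTypeR R) R _
  (measurable_affine a b) leb setT f measurableT mf.
rewrite preimage_setT => <-//.
have a1 : 0 <= a^-1 by rewrite invr_ge0 ltW.
transitivity (\int[mscale (NngNum a1) leb]_x f x)%E.
  apply: eq_measure_integral => [|maff A mA _]; first exact: measurable_affine.
  by rewrite [LHS](lebesgue_measure_affine b a0 mA).
by rewrite ge0_integral_mscale.
Qed.

(** Normalisation of the normal density with mean m and variance 1 / (2 s); [g] is its standard
    deviation. *)
Lemma integral_gauss (s m : R) : 0 < s ->
  (\int[leb]_x (expR (- (s * (m - x) ^+ 2)))%:E = (Num.sqrt (pi / s))%:E)%E.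
Proof.
move=> s0; pose g := Num.sqrt (s *+ 2)^-1.
have s20 : 0 < (s *+ 2)^-1 by rewrite invr_gt0 pmulrn_lgt0.
have g0 : g != 0 by rewrite gt_eqF// sqrtr_gt0.
have g2 : g ^+ 2 = (s *+ 2)^-1 by rewrite sqr_sqrtr// ltW.
have := integral_normal_pdf m g; rewrite normal_pdfE//.
under eq_integral do rewrite EFinM.
rewrite ge0_integralZl//=; last 3 first.
- by apply/measurable_EFinP; exact: measurable_normal_fun.
- by move=> x _; rewrite lee_fin normal_fun_ge0.
- by rewrite lee_fin normal_peak_ge0.
have p0 : 0 < normal_peak g by exact: normal_peak_gt0.
have -> : (\int[leb]_x (expR (- (s * (m - x) ^+ 2)))%:E =
    \int[leb]_x (normal_fun m g x)%:E)%E.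
  apply: eq_integral => x _; rewrite /normal_fun g2; congr (expR _)%:E.
  by field; rewrite gt_eqF.
move=> h; have : ((normal_peak g)^-1%:E * ((normal_peak g)%:E *
  \int[leb]_x (normal_fun m g x)%:E) = (normal_peak g)^-1%:E)%E.
  by rewrite h mule1.
rewrite muleA -EFinM mulVf ?gt_eqF// mul1e => ->.
rewrite /normal_peak invrK g2; congr (Num.sqrt _)%:E.
by field; rewrite gt_eqF.
Qed.

End affine_change.

(** * Lebesgue measure on R^d by slices, and Gaussian kernels *)

Section borel_lebesgue_theory.
Context {R : realType}.
Local Notation leb := (@lebesgue_measure R).
Local Notation bl d := (@borel_lebesgue R d).
Implicit Types d : nat.

(** Unlike the distance, its square is additive over coordinates, so that the kernel [gauss]
    factors. *)
Definition sqdist d (x y : d.-tuple R) : R :=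
  \sum_(i < d) (tnth x i - tnth y i) ^+ 2.

Lemma sqdist_ge0 d (x y : d.-tuple R) : 0 <= sqdist x y.
Proof. by apply: sumr_ge0 => i _; exact: sqr_ge0. Qed.

Lemma sqdistC d (x y : d.-tuple R) : sqdist x y = sqdist y x.
Proof. by apply: eq_bigr => i _; rewrite -sqrrN opprB. Qed.

Lemma sqdist_tcons d (a b : R) (x y : d.-tuple R) :
  sqdist (tcons (a, x)) (tcons (b, y)) = (a - b) ^+ 2 + sqdist x y.
Proof.
rewrite /sqdist big_ord_recl/=; congr (_ + _).
by apply: eq_bigr => i _; rewrite !tnthS.
Qed.

Lemma measurable_sqdist d :
  measurable_fun setT (fun p : d.-tuple R * d.-tuple R => sqdist p.1 p.2).
Proof.
apply: measurable_sum => i; apply: measurable_funX; apply: measurable_funB.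
  by apply: (measurableT_comp (measurable_tnth i)).
by apply: (measurableT_comp (measurable_tnth i)).
Qed.

Lemma measurable_sqdistr d (x : d.-tuple R) : measurable_fun setT (sqdist x).
Proof.
apply: measurable_sum => i; apply: measurable_funX; apply: measurable_funB => //.
exact: measurable_tnth.
Qed.

Definition gauss d (s : R) (x y : d.-tuple R) : R := expR (- (s * sqdist x y)).

Lemma gauss_ge0 d s (x y : d.-tuple R) : 0 <= gauss s x y.
Proof. exact: expR_ge0. Qed.

Lemma gaussC d s (x y : d.-tuple R) : gauss s x y = gauss s y x.
Proof. by rewrite /gauss sqdistC. Qed.

Lemma measurable_gauss d s :
  measurable_fun setT (fun p : d.-tuple R * d.-tuple R => gauss s p.1 p.2).
Proof.
apply: measurableT_comp; first exact: measurable_expR.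
apply: measurable_funN; apply: measurable_funM => //; exact: measurable_sqdist.
Qed.

Lemma measurable_gaussr d s (x : d.-tuple R) : measurable_fun setT (gauss s x).
Proof.
apply: measurableT_comp; first exact: measurable_expR.
apply: measurable_funN; apply: measurable_funM => //; exact: measurable_sqdistr.
Qed.

Lemma borel_lebesgueS d (A : set (d.+1.-tuple R)) :
  bl d.+1 A = (\int[leb]_x bl d [set t | A (tcons (x, t))])%E.
Proof.
rewrite /= /cons_lebesgue /pushforward /product_measure1.
apply: eq_integral => x _ /=; congr borel_lebesgue.
by apply/seteqP; split => t; rewrite /xsection/= inE.
Qed.

Lemma integral_borel_lebesgueS d (f : d.+1.-tuple R -> \bar R) :
  measurable_fun setT f -> (forall x, 0 <= f x)%E ->
  (\int[bl d.+1]_y f y = \int[leb]_x \int[bl d]_t f (tcons (x, t)))%E.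
Proof.
move=> mf f0.
have mc := @measurable_tcons R d.
transitivity (\int[(leb \x bl d)%E]_p f (tcons p))%E; last first.
  rewrite fubini_tonelli1//; apply: measurableT_comp => //.
have := @ge0_integral_pushforward _ _ (measurableTypeR R * d.-tuple R)%type _ R
  (@tcons R d) mc (leb \x bl d)%E setT f measurableT mf.
by rewrite preimage_setT => <-//.
Qed.

Lemma integral_gauss_tuple d s (x : d.-tuple R) : 0 < s ->
  (\int[bl d]_y (gauss s x y)%:E = (Num.sqrt (pi / s) ^+ d)%:E)%E.
Proof.
move=> s0; elim: d x => [|d IH] x.
  rewrite expr0 (eq_measure_integral (dirac [tuple]))// integral_dirac//.
    by rewrite /gauss /sqdist big_ord0 mulr0 oppr0 expR0 diracT mul1e.
  by apply/measurable_EFinP; exact: measurable_gaussr.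
rewrite integral_borel_lebesgueS; last 2 first.
- by apply/measurable_EFinP; exact: measurable_gaussr.
- by move=> y; rewrite lee_fin gauss_ge0.
case/tupleP: x => x0 x.
have E y0 (y : d.-tuple R) : gauss s [tuple of x0 :: x] (tcons (y0, y)) =
    expR (- (s * (x0 - y0) ^+ 2)) * gauss s x y.
  by rewrite /gauss (sqdist_tcons x0 y0) mulrDr opprD expRD.
have inner y0 : (\int[bl d]_y (gauss s [tuple of x0 :: x] (tcons (y0, y)))%:E =
    (Num.sqrt (pi / s) ^+ d)%:E * (expR (- (s * (x0 - y0) ^+ 2)))%:E)%E.
  under eq_integral do rewrite E EFinM.
  rewrite ge0_integralZl//; first by rewrite IH muleC.
  - by apply/measurable_EFinP; exact: measurable_gaussr.
  - by move=> y _; rewrite lee_fin gauss_ge0.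
under eq_integral do rewrite inner.
rewrite ge0_integralZl//; last first.
- apply/measurable_EFinP; apply: measurableT_comp; first exact: measurable_expR.
  by apply: measurable_funN; apply: measurable_funM => //;
    apply: measurable_funX; apply: measurable_funB.
by rewrite integral_gauss// -EFinM exprSr.
Qed.

Definition affine d (a : R) (b x : d.-tuple R) : d.-tuple R :=
  [tuple a * tnth x i + tnth b i | i < d].

Lemma measurable_tcons_section d (A : set (d.+1.-tuple R)) (x : R) :
  measurable A -> measurable [set t : d.-tuple R | A (tcons (x, t))].
Proof.
move=> mA; rewrite -[X in measurable X]setTI.
have mf : measurable_fun setT (fun t : d.-tuple R => tcons (x, t)).
  apply: measurableT_comp; first exact: measurable_tcons.
  exact: measurable_pair1.
exact: mf.
Qed.

(** Induction on d: the slice at x of the preimage is the preimage of the slice at a x + b0. *)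
Lemma borel_lebesgue_affine d a (b : d.-tuple R) (A : set (d.-tuple R)) :
  0 < a -> measurable A ->
  bl d (affine a b @^-1` A) = ((a^-1 ^+ d)%:E * bl d A)%E.
Proof.
move=> a0; elim: d b A => [|d IH] b A mA.
  by rewrite expr0 mul1e; congr dirac; apply/seteqP; split=> x/=;
    rewrite [affine _ _ _]tuple0 [x]tuple0.
rewrite !borel_lebesgueS; case/tupleP: b => b0 b.
have E x : [set t | (affine a [tuple of b0 :: b] @^-1` A) (tcons (x, t))] =
    affine a b @^-1` [set t | A (tcons (a * x + b0, t))].
  have Et t : affine a [tuple of b0 :: b] (tcons (x, t)) =
      tcons (a * x + b0, affine a b t).
    apply: eq_from_tnth => i; rewrite tnth_mktuple.
    case: (unliftP ord0 i) => [j ->|->]; last by rewrite !tnth0.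
    by rewrite !tnthS tnth_mktuple.
  by apply/seteqP; split => t/=; rewrite Et.
under eq_integral => x _.
  rewrite E IH//; last exact: measurable_tcons_section.
  over.
have mS : measurable_fun setT (fun x : R => bl d [set t | A (tcons (x, t))]).
  have mA' : measurable (@tcons R d @^-1` A).
    by rewrite -[X in measurable X]setTI; exact: measurable_tcons.
  have := measurable_fun_xsection (bl d) mA'.
  congr (measurable_fun _ _); apply/funext => x/=; congr borel_lebesgue.
  by apply/seteqP; split => t; rewrite /xsection/= inE.
rewrite ge0_integralZl//; last 2 first.
- exact: (@measurableT_comp _ _ _ _ _ _ _ _ _ mS (measurable_affine a b0)).
- by rewrite lee_fin exprn_ge0// invr_ge0 ltW.
rewrite (@integral_affine _ a b0 (fun x => bl d [set t | A (tcons (x, t))]))//.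
by rewrite muleA -EFinM exprSr.
Qed.

End borel_lebesgue_theory.

(** * Volumes of balls and the size of r_d *)

Section ball_volume.
Context {R : realType}.
Local Notation bl d := (@borel_lebesgue R d).
Implicit Types d : nat.

Lemma vol_borelE d (A : set (d.-tuple R)) : measurable A -> vol A = bl d A.
Proof. by move=> mA; rewrite /vol /completed_measure_extension measurable_mu_extE. Qed.

Lemma eucl_distE d (x y : d.-tuple R) : eucl_dist x y = Num.sqrt (sqdist x y).
Proof. by []. Qed.

Lemma eucl_dist_ltE d (x y : d.-tuple R) r : 0 <= r ->
  (eucl_dist x y < r) = (sqdist x y < r ^+ 2).
Proof.
move=> r0; rewrite eucl_distE -{1}(ger0_norm r0) -sqrtr_sqr.
have [->|rn0] := eqVneq r 0.
  by rewrite expr0n/= sqrtr0 !ltNge sqrtr_ge0 sqdist_ge0.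
by rewrite ltr_sqrt// exprn_gt0// lt_def rn0.
Qed.

Lemma eucl_dist_leE d (x y : d.-tuple R) r : 0 <= r ->
  (eucl_dist x y <= r) = (sqdist x y <= r ^+ 2).
Proof.
move=> r0; rewrite eucl_distE -{1}(ger0_norm r0) -sqrtr_sqr.
by rewrite ler_sqrt// exprn_ge0.
Qed.

Lemma eucl_ballE d (c : d.-tuple R) r : 0 <= r ->
  eucl_ball c r = [set x | sqdist c x <= r ^+ 2].
Proof. by move=> r0; apply/seteqP; split => x/=; rewrite /eucl_ball/= eucl_dist_leE. Qed.

Lemma measurable_eucl_ball d (c : d.-tuple R) r : 0 <= r ->
  measurable (eucl_ball c r).
Proof.
move=> r0; rewrite eucl_ballE// -[X in measurable X]setTI.
have := @measurable_sqdistr R d c measurableT `]-oo, r ^+ 2]%classic.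
rewrite (_ : _ @^-1` _ = [set x | sqdist c x <= r ^+ 2]); first by apply.
by apply/seteqP; split => x/=; rewrite in_itv.
Qed.

Lemma borel_lebesgue_ball d (c : d.-tuple R) (a r : R) : 0 < a -> 0 <= r ->
  bl d (eucl_ball c (a * r)) = ((a ^+ d)%:E * bl d (eucl_ball (origin d) r))%E.
Proof.
move=> a0 r0; pose b := [tuple - (a^-1 * tnth c i) | i < d].
have -> : eucl_ball c (a * r) = affine a^-1 b @^-1` eucl_ball (origin d) r.
  rewrite !eucl_ballE ?mulr_ge0// ?ltW//; apply/seteqP.
  have E x : sqdist (origin d) (affine a^-1 b x) = (a ^+ 2)^-1 * sqdist c x.
    rewrite /sqdist mulr_sumr; apply: eq_bigr => i _.
    by rewrite !tnth_mktuple; field; rewrite gt_eqF.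
  by split=> x/=; rewrite E exprMn ler_pdivrMl// exprn_gt0.
rewrite borel_lebesgue_affine ?invr_gt0//; first by rewrite invrK.
exact: measurable_eucl_ball.
Qed.

(** The Gaussian kernel has finite integral and is at least exp (- r^2) on the ball. *)
Lemma borel_lebesgue_ball_fin d (c : d.-tuple R) r : 0 <= r ->
  bl d (eucl_ball c r) \is a fin_num.
Proof.
move=> r0; rewrite ge0_fin_numE//.
have mB := measurable_eucl_ball c r0.
suff : ((expR (- r ^+ 2))%:E * bl d (eucl_ball c r) <= (Num.sqrt (pi / 1) ^+ d)%:E)%E.
  case: (bl d _) (measure_ge0 (bl d) (eucl_ball c r)) => [x| |]//= _; first by rewrite ltry.
  by rewrite gt0_muley ?lte_fin ?expR_gt0// leye_eq.
rewrite -(integral_gauss_tuple c)// -integral_cst//.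
apply: (@le_trans _ _ (\int[bl d]_(y in eucl_ball c r) (gauss 1 c y)%:E)%E).
  apply: ge0_le_integral => //.
  - by move=> x _; rewrite lee_fin expR_ge0.
  - by apply/measurable_EFinP; apply: measurable_funTS; exact: measurable_gaussr.
  - move=> x; rewrite eucl_ballE//= => xr.
    by rewrite lee_fin ler_expR mul1r lerN2.
apply: ge0_subset_integral => // [|x _]; last by rewrite lee_fin gauss_ge0.
by apply/measurable_EFinP; exact: measurable_gaussr.
Qed.

(** Under the probability density [gauss pi] the squared distance has mean d / (2 pi). The three
    terms dominate this density below, above and inside the window [a, b] around the mean; the first
    two come from tilting the exponent by t. *)
Lemma gauss_chernoff d (kappa : R) (x y : d.-tuple R) :
  let t := kappa / 4 in
  let a := (1 - kappa) * d%:R / (2 * pi) in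
  let b := (1 + kappa) * d%:R / (2 * pi) in
  0 < kappa -> kappa <= 1 ->
  gauss pi x y <= expR (pi * t * a) * gauss (pi * (1 + t)) x y +
    expR (- (pi * t * b)) * gauss (pi * (1 - t)) x y +
    expR (- (pi * a)) * \1_(eucl_ball x (Num.sqrt b)) y.
Proof.
move=> t a b k0 k1; have p0 := pi_gt0 R.
have b0 : 0 <= b by rewrite mulr_ge0 ?mulr_ge0 ?invr_ge0//; lra.
set q := sqdist x y.
have pt : 0 < pi * t by rewrite mulr_gt0// /t; lra.
rewrite /gauss -/q -!expRD.
set A := expR (_ + _); set B := expR (_ + _); set C := _ * \1_ _ _.
have A0 : 0 <= A by exact: expR_ge0.
have B0 : 0 <= B by exact: expR_ge0.
have C0 : 0 <= C by rewrite mulr_ge0 ?expR_ge0// indicE.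
have [qa|aq] := ltP q a.
  suff : expR (- (pi * q)) <= A by lra.
  rewrite ler_expR; suff : 0 <= pi * t * (a - q) by lra.
  by rewrite mulr_ge0 ?subr_ge0 ?ltW.
have [qb|bq] := leP q b; last first.
  suff : expR (- (pi * q)) <= B by lra.
  rewrite ler_expR; suff : 0 <= pi * t * (q - b) by lra.
  by rewrite mulr_ge0 ?subr_ge0 ?ltW.
suff : expR (- (pi * q)) <= C by lra.
rewrite /C indicE mem_set ?mulr1; last by rewrite eucl_ballE ?sqrtr_ge0//= sqr_sqrtr.
by rewrite ler_expR lerN2 ler_pM2l.
Qed.

Lemma sqrt_exprn_le_expR (x c : R) d : 0 <= x -> x <= expR c ->
  Num.sqrt x ^+ d <= expR (c * d%:R / 2).
Proof.
move=> x0 xc.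
have -> : expR (c * d%:R / 2) = expR (c / 2) ^+ d.
  by rewrite -expRM_natl; congr expR; lra.
rewrite lerXn2r ?nnegrE ?sqrtr_ge0 ?expR_ge0//.
rewrite -[leRHS]ger0_norm ?expR_ge0// -sqrtr_sqr ler_sqrt ?exprn_ge0 ?expR_ge0//.
by rewrite -expRM_natl mulrC divfK.
Qed.

(** Integrating [gauss_chernoff] over y, each of the two tails contributes at most 1/4, so exp (- pi
    a) times the volume of the ball is at least 1/2. *)
Lemma ball_volume_ge d (kappa : R) (c : d.-tuple R) : 0 < kappa -> kappa <= 1 ->
  64 <= kappa ^+ 2 * d%:R ->
  ((expR ((1 - kappa) * d%:R / 2) / 2)%:E <=
    bl d (eucl_ball c (Num.sqrt ((1 + kappa) * d%:R / (2 * pi)))))%E.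
Proof.
move=> k0 k1 kd; have p0 := pi_gt0 R.
pose t := kappa / 4.
pose a := (1 - kappa) * d%:R / (2 * pi).
pose b := (1 + kappa) * d%:R / (2 * pi).
have cancel_pi (x p : R) : 0 < p -> p * (x / (2 * p)) = x / 2.
  by move=> q0; field; rewrite gt_eqF.
have pa : pi * a = (1 - kappa) * d%:R / 2 by exact: cancel_pi.
have pb : pi * b = (1 + kappa) * d%:R / 2 by exact: cancel_pi.
have t0 : 0 < t by rewrite /t; lra.
have t4 : t <= 1 / 4 by rewrite /t; lra.
set B := eucl_ball c _.
have mB : measurable B by apply: measurable_eucl_ball; exact: sqrtr_ge0.
have Bfin : bl d B \is a fin_num by apply: borel_lebesgue_ball_fin; exact: sqrtr_ge0.
pose C1 := expR (pi * t * a); pose C2 := expR (- (pi * t * b)).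
pose C3 := expR (- (pi * a)).
have mg s : measurable_fun setT (fun y => (gauss s c y)%:E).
  by apply/measurable_EFinP; exact: measurable_gaussr.
have int1 : (1 <= (C1 * Num.sqrt (pi / (pi * (1 + t))) ^+ d)%:E +
   (C2 * Num.sqrt (pi / (pi * (1 - t))) ^+ d)%:E + C3%:E * bl d B)%E.
  have <- : (\int[bl d]_y (gauss pi c y)%:E = 1)%E.
    by rewrite integral_gauss_tuple// divff ?gt_eqF// sqrtr1 expr1n.
  have Es s C : 0 < s -> 0 <= C -> (\int[bl d]_y (C%:E * (gauss s c y)%:E) =
      (C * Num.sqrt (pi / s) ^+ d)%:E)%E.
    move=> s0 C0; rewrite ge0_integralZl ?lee_fin//.
      by rewrite integral_gauss_tuple.
    by move=> y _; rewrite lee_fin gauss_ge0.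
  have E3 : (\int[bl d]_y (C3%:E * (\1_B y)%:E) = C3%:E * bl d B)%E.
    rewrite ge0_integralZl ?integral_indic ?setIT ?lee_fin ?expR_ge0//.
    exact/measurable_EFinP.
  rewrite -Es ?mulr_gt0 ?expR_ge0//; last lra.
  rewrite -[X in (_ + X + _)%E]Es ?mulr_gt0 ?expR_ge0//; last lra.
  rewrite -E3.
  have mC s C : measurable_fun setT (fun y => (C%:E * (gauss s c y)%:E))%E.
    exact: measurable_funeM.
  have m3 : measurable_fun setT (fun y => C3%:E * (\1_B y)%:E)%E.
    by apply: measurable_funeM; exact/measurable_EFinP.
  rewrite -ge0_integralD//; last 2 first.
  - by move=> y _; rewrite mule_ge0 ?lee_fin ?expR_ge0.
  - by move=> y _; rewrite mule_ge0 ?lee_fin ?expR_ge0.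
  rewrite -ge0_integralD//; last 3 first.
  - by move=> y _; rewrite adde_ge0// mule_ge0 ?lee_fin ?expR_ge0.
  - exact: emeasurable_funD.
  - by move=> y _; rewrite mule_ge0 ?lee_fin ?expR_ge0.
  apply: ge0_le_integral => //.
  - by move=> y _; rewrite lee_fin gauss_ge0.
  - by apply: emeasurable_funD => //; exact: emeasurable_funD.
  - move=> y _; rewrite -!EFinM -!EFinD lee_fin.
    exact: gauss_chernoff.
have tail : expR (- 4) <= 1 / 4 :> R.
  rewrite expRN -div1r ler_pdivrMr ?expR_gt0//.
  have := expR_ge1Dx (4 : R); lra.
(* The value t = kappa / 4 minimises - t kappa + 2 t^2. The minimum - kappa^2 / 8 turns kappa^2 d >=
   64 into the exponent - 4. *)
have expo : (- t * kappa + 2 * t ^+ 2) * d%:R / 2 <= - 4.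
  have -> : (- t * kappa + 2 * t ^+ 2) * d%:R / 2 = - (kappa ^+ 2 * d%:R) / 16.
    by rewrite /t; field.
  lra.
have pit (s : R) : 0 < s -> pi / (pi * s) = s^-1.
  by move=> s0; rewrite invfM mulVKf ?gt_eqF.
(* From 1 / (1 + t) <= 1 - t + t^2 <= exp (- (t - t^2)). *)
have T1 : C1 * Num.sqrt (pi / (pi * (1 + t))) ^+ d <= 1 / 4.
  rewrite pit; last lra.
  apply: (@le_trans _ _ (C1 * expR (- (t - t ^+ 2) * d%:R / 2))).
    rewrite ler_wpM2l ?expR_ge0// sqrt_exprn_le_expR//; first by rewrite invr_ge0; lra.
    apply: (@le_trans _ _ (1 - (t - t ^+ 2))); last exact: expR_ge1Dx.
    rewrite -div1r ler_pdivrMr; last lra.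
    have : 0 <= t ^+ 3 by rewrite exprn_ge0// ltW.
    lra.
  rewrite -expRD; apply: le_trans tail; rewrite ler_expR; apply: le_trans expo.
  have -> : pi * t * a = t * ((1 - kappa) * d%:R / 2) by rewrite -pa mulrAC mulrC.
  have : 0 <= t ^+ 2 * d%:R by rewrite mulr_ge0// exprn_ge0// ltW.
  lra.
(* From 1 / (1 - t) <= 1 + t + 2 t^2, which holds for 0 <= t <= 1/2. *)
have T2 : C2 * Num.sqrt (pi / (pi * (1 - t))) ^+ d <= 1 / 4.
  rewrite pit; last lra.
  apply: (@le_trans _ _ (C2 * expR ((t + 2 * t ^+ 2) * d%:R / 2))).
    rewrite ler_wpM2l ?expR_ge0// sqrt_exprn_le_expR//; first by rewrite invr_ge0; lra.
    apply: (@le_trans _ _ (1 + (t + 2 * t ^+ 2))); last exact: expR_ge1Dx.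
    rewrite -div1r ler_pdivrMr; last lra.
    suff : 0 <= t ^+ 2 * (1 - 2 * t) by lra.
    by rewrite mulr_ge0 ?exprn_ge0 ?ltW//; lra.
  rewrite -expRD; apply: le_trans tail; rewrite ler_expR; apply: le_trans expo.
  have -> : pi * t * b = t * ((1 + kappa) * d%:R / 2) by rewrite -pb mulrAC mulrC.
  lra.
move: int1; rewrite -(fineK Bfin) -EFinM -!EFinD !lee_fin => int1.
have : 1 / 2 <= C3 * fine (bl d B) by lra.
have -> : expR ((1 - kappa) * d%:R / 2) = C3^-1.
  by rewrite /C3 -expRN opprK pa.
by rewrite -ler_pdivrMl ?expR_gt0// mul1r.
Qed.

(** As [xget] could return its default 0, a suitable radius must be exhibited: a ball of positive
    finite volume v is rescaled by v^(-1/d). Its volume is positive by [ball_volume_ge] with kappa =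
    1, whence the 64. *)
Lemma unit_volume_radiusP d : (64 <= d)%N ->
  0 < unit_volume_radius R d /\
  bl d (eucl_ball (origin d) (unit_volume_radius R d)) = 1%E.
Proof.
move=> d64; have d0 : 0 < d%:R :> R by rewrite ltr0n (leq_trans _ d64).
have p0 := pi_gt0 R.
have := @ball_volume_ge d 1 (origin d) ltr01 (lexx _).
rewrite expr1n mul1r (ler_nat R 64) => /(_ d64).
set r := Num.sqrt _ => Vge.
have r0 : 0 < r by rewrite sqrtr_gt0 divr_gt0// mulr_gt0//; lra.
have Vfin := borel_lebesgue_ball_fin (origin d) (ltW r0).
set v := fine (bl d (eucl_ball (origin d) r)).
have v0 : 0 < v.
  rewrite -lte_fin /v fineK//; apply: lt_le_trans Vge.
  by rewrite lte_fin divr_gt0// expR_gt0.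
pose s := v `^ (- d%:R^-1).
have s0 : 0 < s by rewrite powR_gt0.
have sd : s ^+ d = v^-1.
  rewrite -powR_mulrn ?ltW// -powRrM mulNr mulVf ?gt_eqF//.
  by rewrite powRN powRr1// ltW.
have ex : [set r : R | 0 < r /\ vol (eucl_ball (origin d) r) = 1%E] (s * r).
  split; first by rewrite mulr_gt0.
  rewrite vol_borelE; last by apply: measurable_eucl_ball; rewrite mulr_ge0 ?ltW.
  rewrite borel_lebesgue_ball// ?ltW// sd -(fineK Vfin) -/v -EFinM mulVf//.
  by rewrite gt_eqF.
rewrite /unit_volume_radius; have [u0 u1] := xgetPex 0 (ex_intro _ _ ex).
split=> //; rewrite -vol_borelE//; apply: measurable_eucl_ball; exact: ltW.
Qed.

(** Asymptotically r_d^2 is d / (2 pi e). If r_d were larger than stated, scaling would make the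
    ball of [ball_volume_ge] too small. *)
Lemma unit_volume_radius_le d (kappa : R) : 0 < kappa -> kappa <= 1 ->
  64 <= kappa ^+ 2 * d%:R ->
  unit_volume_radius R d ^+ 2 <= d%:R / (2 * pi) * expR (3 * kappa - 1).
Proof.
move=> k0 k1 kd; have p0 := pi_gt0 R.
have kk : kappa ^+ 2 <= kappa by rewrite expr2 ler_piMl// ltW.
have d64 : (64 <= d)%N.
  rewrite -(ler_nat R); apply: (le_trans kd); rewrite ler_piMl//; lra.
have d0 : 0 < d%:R :> R by rewrite ltr0n (leq_trans _ d64).
have [u0 u1] := unit_volume_radiusP d64.
set u := unit_volume_radius R d in u0 u1 *.
have := @ball_volume_ge d kappa (origin d) k0 k1 kd.
set b := (1 + kappa) * d%:R / (2 * pi).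
have b0 : 0 < b by rewrite /b divr_gt0 ?mulr_gt0//; lra.
have sb0 : 0 < Num.sqrt b by rewrite sqrtr_gt0.
have -> : Num.sqrt b = Num.sqrt b / u * u by rewrite divfK// gt_eqF.
rewrite borel_lebesgue_ball ?divr_gt0//; last exact: ltW.
rewrite u1 mule1 lee_fin => h.
rewrite leNgt; apply/negP => hu.
(* Of the 3 kappa, one absorbs the factor 1 + kappa of [b], one the loss in the exponent of
   [ball_volume_ge], and one its factor 1/2. *)
have bu : b / u ^+ 2 <= expR (1 - 2 * kappa).
  rewrite ler_pdivrMr ?exprn_gt0//.
  apply: (@le_trans _ _ (expR (1 - 2 * kappa) *
      (d%:R / (2 * pi) * expR (3 * kappa - 1)))); last first.
    by rewrite ler_wpM2l ?expR_ge0// ltW.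
  rewrite mulrCA -expRD /b -mulrA mulrC ler_wpM2l//.
    by rewrite divr_ge0// ?ltW// mulr_gt0.
  by apply: le_trans (expR_ge1Dx kappa) _; rewrite ler_expR; lra.
have : (Num.sqrt b / u) ^+ d <= expR ((1 - 2 * kappa) * d%:R / 2).
  have -> : Num.sqrt b / u = Num.sqrt (b / u ^+ 2).
    rewrite [RHS]sqrtrM; last exact: ltW.
    by rewrite sqrtrV ?exprn_ge0 ?(ltW u0)// sqrtr_sqr ger0_norm// ltW.
  by rewrite sqrt_exprn_le_expR// divr_ge0// ?exprn_ge0// ltW.
move=> /(le_trans h); rewrite ler_pdivrMr// leNgt => /negP; apply.
have -> : (1 - kappa) * d%:R / 2 = (1 - 2 * kappa) * d%:R / 2 + kappa * d%:R / 2 by lra.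
rewrite expRD ltr_pM2l ?expR_gt0//.
have := expR_ge1Dx (kappa * d%:R / 2).
have : kappa ^+ 2 * d%:R <= kappa * d%:R by rewrite ler_wpM2r.
lra.
Qed.

End ball_volume.

(** * Gaussian masses of sets, and averaging over the points of cells *)

Section gauss_mass.
Context {R : realType} (d : nat).
Local Notation bl := (@borel_lebesgue R d).
Local Notation T := (d.-tuple R).
Implicit Types (sg : R) (B : set T).

Definition gauss_mass sg B (c : T) : R :=
  fine (\int[bl]_(x in B) (gauss sg x c)%:E)%E.

Lemma measurable_gaussl sg (c : T) : measurable_fun setT (gauss sg ^~ c).
Proof.
by rewrite (_ : _ ^~ c = gauss sg c);
  [exact: measurable_gaussr|apply/funext => x; rewrite gaussC].
Qed.

Lemma gauss_integral_le sg B c : 0 < sg -> measurable B ->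
  (\int[bl]_(x in B) (gauss sg x c)%:E <= (Num.sqrt (pi / sg) ^+ d)%:E)%E.
Proof.
move=> sg0 mB; rewrite -(integral_gauss_tuple c)//.
under [in leRHS]eq_integral do rewrite gaussC.
apply: ge0_subset_integral => // [|x _]; last by rewrite lee_fin gauss_ge0.
by apply/measurable_EFinP; exact: measurable_gaussl.
Qed.

Lemma gauss_massE sg B c : 0 < sg -> measurable B ->
  (gauss_mass sg B c)%:E = (\int[bl]_(x in B) (gauss sg x c)%:E)%E.
Proof.
move=> sg0 mB; rewrite /gauss_mass fineK// ge0_fin_numE.
  by apply: le_lt_trans (gauss_integral_le c sg0 mB) _; rewrite ltry.
by apply: integral_ge0 => x _; rewrite lee_fin gauss_ge0.
Qed.

Lemma gauss_mass_ge0 sg B c : 0 <= gauss_mass sg B c.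
Proof. by apply: fine_ge0; apply: integral_ge0 => x _; rewrite lee_fin gauss_ge0. Qed.

Lemma measurable_gauss_kernel sg B (H : T -> R) : measurable B ->
  measurable_fun setT H ->
  measurable_fun setT
    (fun p : T * T => (H p.2 * gauss sg p.1 p.2 * \1_B p.1)%:E).
Proof.
move=> mB mH; apply/measurable_EFinP; apply: measurable_funM.
  apply: measurable_funM; last exact: measurable_gauss.
  exact: measurableT_comp.
by apply: (@measurableT_comp _ _ _ _ _ _ (\1_B : T -> R)).
Qed.

Lemma gauss_tonelli sg B (H : T -> R) : 0 < sg -> measurable B ->
  measurable_fun setT H -> (forall c, 0 <= H c) ->
  (\int[bl]_(z in B) \int[bl]_c (H c * gauss sg z c)%:E =
   \int[bl]_c (H c * gauss_mass sg B c)%:E)%E.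
Proof.
move=> sg0 mB mH H0.
have E (z : T) : ((fun z => \int[bl]_c (H c * gauss sg z c)%:E)%E \_ B) z =
    (\int[bl]_c (H c * gauss sg z c * \1_B z)%:E)%E.
  rewrite patchE indicE; case: ifPn => zB.
    by apply: eq_integral => c _; rewrite mulr1.
  by under eq_integral do rewrite mulr0; rewrite integral0.
rewrite integral_mkcond; under eq_integral do rewrite E.
rewrite (@fubini_tonelli _ _ _ _ _ bl bl
  (fun p : T * T => (H p.2 * gauss sg p.1 p.2 * \1_B p.1)%:E)); last 2 first.
- exact: measurable_gauss_kernel.
- by move=> p; rewrite lee_fin !mulr_ge0// ?gauss_ge0// indicE.
apply: eq_integral => c _ /=; rewrite EFinM gauss_massE// [in RHS]integral_mkcond.
rewrite -ge0_integralZl//; last 3 first.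
- apply: (measurable_restrictT _ mB).1; apply: measurable_funTS.
  by apply/measurable_EFinP; exact: measurable_gaussl.
- by move=> x _; rewrite patchE; case: ifPn; rewrite ?lee_fin ?gauss_ge0.
- by rewrite lee_fin.
apply: eq_integral => x _; rewrite patchE indicE.
by case: ifPn => xB; [rewrite mulr1 -EFinM|rewrite mulr0 mule0].
Qed.

Lemma integral_gauss_mass sg B : 0 < sg -> measurable B ->
  (\int[bl]_c (gauss_mass sg B c)%:E = (Num.sqrt (pi / sg) ^+ d)%:E * bl B)%E.
Proof.
move=> sg0 mB; transitivity (\int[bl]_c (1 * gauss_mass sg B c)%:E)%E.
  by apply: eq_integral => c _; rewrite mul1r.
rewrite -(@gauss_tonelli sg B (fun=> 1))// -integral_cst//.
apply: eq_integral => z _; under eq_integral do rewrite mul1r.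
by rewrite integral_gauss_tuple.
Qed.

Lemma measurable_gauss_mass sg B : 0 < sg -> measurable B ->
  measurable_fun setT (gauss_mass sg B).
Proof.
move=> sg0 mB; apply/measurable_EFinP.
have m1 : measurable_fun setT (fun=> 1 : R) by [].
have k0 (p : T * T) : (0 <= ((fun=> 1) p.2 * gauss sg p.1 p.2 * \1_B p.1)%:E)%E.
  by rewrite lee_fin !mulr_ge0// ?gauss_ge0// indicE.
have := @measurable_fun_fubini_tonelli_G _ _ _ _ _ bl
  _ (@measurable_gauss_kernel sg B (fun=> 1) mB (m1 _ _)) k0.
congr (measurable_fun _ _); apply/funext => c/=.
rewrite gauss_massE// integral_mkcond /fubini_G/=.
apply: eq_integral => x _; rewrite patchE indicE mul1r.
by case: ifPn => xB; rewrite ?mulr1 ?mulr0.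
Qed.

(* The points are integrated out over the cells one at a time. *)
Lemma gauss_average sg (B : nat -> set T) n (H : T -> R) (K : R) : 0 < sg ->
  (forall l, measurable (B l)) -> (forall l, bl (B l) \is a fin_num) ->
  measurable_fun setT H -> (forall c, 0 <= H c) -> 0 <= K ->
  (forall x : nat -> T, (forall l, (l < n)%N -> B l (x l)) ->
    K%:E <= \int[bl]_c (H c * \prod_(l < n) gauss sg (x l) c)%:E)%E ->
  ((K * \prod_(l < n) fine (bl (B l)))%:E <=
    \int[bl]_c (H c * \prod_(l < n) gauss_mass sg (B l) c)%:E)%E.
Proof.
move=> sg0 mB Bfin mH H0 K0.
elim: n H mH H0 => [|n IH] H mH H0 hK.
  rewrite big_ord0 mulr1; apply: le_trans (hK (fun=> origin d) _) _ => //.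
  by under eq_integral do rewrite big_ord0; under [leRHS]eq_integral do rewrite big_ord0.
pose G c := H c * \prod_(l < n) gauss_mass sg (B l) c.
have mG : measurable_fun setT G.
  apply: measurable_funM => //; apply: measurable_prod => l _.
  exact: measurable_gauss_mass.
have G0 c : 0 <= G c by rewrite mulr_ge0// prodr_ge0// => l _; exact: gauss_mass_ge0.
(* The point z of the last set is absorbed into the weight [H], and the induction hypothesis handles
   the other n. *)
have step z : B n z -> ((K * \prod_(l < n) fine (bl (B l)))%:E <=
    \int[bl]_c (G c * gauss sg z c)%:E)%E.
  move=> Bz; have := IH (fun c => H c * gauss sg z c).
  move=> /(_ (measurable_funM mH (measurable_gaussr sg z))).
  move=> /(_ (fun c => mulr_ge0 (H0 c) (gauss_ge0 _ _ _))).
  move=> h; apply: le_trans (h _) _ => [x Bx|].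
    have /hK : forall l, (l < n.+1)%N -> B l (if (l < n)%N then x l else z).
      move=> l; rewrite ltnS leq_eqVlt => /orP[/eqP->|ln]; first by rewrite ltnn.
      by rewrite ln; exact: Bx.
    congr (_ <= _)%E; apply: eq_integral => c _; congr EFin.
    rewrite big_ord_recr/= ltnn [X in _ * X = _]mulrC mulrA; congr (_ * _).
    by apply: eq_bigr => l _; rewrite ltn_ord.
  by rewrite le_eqVlt; apply/orP; left; apply/eqP; apply: eq_integral => c _;
    congr EFin; rewrite mulrAC.
rewrite big_ord_recr/= mulrA EFinM fineK// -integral_cst//.
under [leRHS]eq_integral do rewrite big_ord_recr/= mulrA.
rewrite -gauss_tonelli//.
apply: ge0_le_integral => //.
- move=> z _; rewrite lee_fin mulr_ge0// prodr_ge0// => l _; exact: fine_ge0.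
- apply: measurable_funTS.
  apply: (@measurable_fun_fubini_tonelli_F _ _ _ _ _ bl
    (fun p : T * T => (G p.2 * gauss sg p.1 p.2)%:E)).
    apply/measurable_EFinP; apply: measurable_funM; last exact: measurable_gauss.
    exact: measurableT_comp.
  by move=> p; rewrite lee_fin mulr_ge0 ?gauss_ge0.
Qed.

End gauss_mass.

(** * Gaussian bound on the number of complete bipartite configurations *)

Section complete_bipartite_count.
Context {R : realType} (d : nat).
Local Notation bl := (@borel_lebesgue R d).
Local Notation T := (d.-tuple R).

(** The parallel axis theorem: c is the centroid of the points and W their total squared distance to
    it. *)
Lemma sqdist_centroid m (x : nat -> T) : exists (c : T) (W : R), forall y,
  \sum_(l < m.+1) sqdist (x l) y = m.+1%:R * sqdist c y + W.
Proof.
pose c := [tuple (\sum_(l < m.+1) tnth (x l) i) / m.+1%:R | i < d].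
exists c, (\sum_(l < m.+1) sqdist (x l) c) => y.
rewrite /sqdist exchange_big/= mulr_sumr [X in _ + X]exchange_big/= -big_split/=.
apply: eq_bigr => i _; apply/eqP; rewrite -subr_eq -sumrB; apply/eqP.
set ci := tnth c i; set yi := tnth y i.
have sc : \sum_(l < m.+1) tnth (x l) i = m.+1%:R * ci.
  by rewrite /ci tnth_mktuple mulrC divfK.
transitivity (\sum_(l < m.+1) ((ci - yi) * 2 * tnth (x l) i - (ci - yi) * (yi + ci))).
  by apply: eq_bigr => l _; ring.
rewrite sumrB -mulr_sumr sc sumr_const card_ord -mulr_natl; ring.
Qed.

(** The centroid and W are chosen before s, so that different Gaussian parameters can be
    compared. *)
Lemma prod_gauss_centroid m (x : nat -> T) : exists (c : T) (W : R), forall s y,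
  \prod_(l < m.+1) gauss s (x l) y = expR (- (s * W)) * gauss (s * m.+1%:R) c y.
Proof.
have [c [W E]] := sqdist_centroid m x; exists c, W => s y.
rewrite /gauss -expR_sum -expRD; congr expR.
by rewrite sumrN -mulr_sumr E; ring.
Qed.

Lemma measurable_prod_gauss m s (x : nat -> T) :
  measurable_fun setT (fun y => (\prod_(l < m) gauss s (x l) y)%:E).
Proof.
apply/measurable_EFinP; apply: measurable_prod => l _.
exact: measurable_gaussr.
Qed.

(** The (m+1)-st power of the first integral carries the same factor exp (- sg W) as the second
    integral: their ratio does not depend on the points. *)
Lemma integral_prod_gauss_pow m (sg : R) (x : nat -> T) : 0 < sg ->
  exists W : R,
  (\int[bl]_y (\prod_(l < m.+1) gauss (sg / m.+1%:R) (x l) y)%:E =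
    (expR (- (sg / m.+1%:R * W)) * Num.sqrt (pi / sg) ^+ d)%:E /\
   \int[bl]_y (\prod_(l < m.+1) gauss sg (x l) y)%:E =
    (expR (- (sg * W)) * Num.sqrt (pi / (sg * m.+1%:R)) ^+ d)%:E)%E.
Proof.
move=> sg0; have [c [W E]] := prod_gauss_centroid m x; exists W.
have I s : 0 < s -> (\int[bl]_y (\prod_(l < m.+1) gauss s (x l) y)%:E =
    (expR (- (s * W)) * Num.sqrt (pi / (s * m.+1%:R)) ^+ d)%:E)%E.
  move=> s0; under eq_integral do rewrite E EFinM.
  rewrite ge0_integralZl//.
  - by rewrite integral_gauss_tuple// mulr_gt0.
  - by apply/measurable_EFinP; exact: measurable_gaussr.
  - by move=> y _; rewrite lee_fin gauss_ge0.
split; last exact: I.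
by rewrite I ?divr_gt0// divfK.
Qed.

Context {V : finType}.
Variables (A : V -> set T) (e : rel V) (a : V -> R) (rho D : R).
Hypotheses (mA : forall i, measurable (A i)) (tA : trivIset setT A).
Hypothesis eA : forall i j x y, e i j -> A i x -> A j y -> sqdist x y <= rho.
Hypotheses (a_ge0 : forall i, 0 <= a i) (aA : forall i, ((a i)%:E <= bl (A i))%E).
Hypothesis AD : (\sum_i bl (A i) <= D%:E)%E.

Let Afin i : bl (A i) \is a fin_num.
Proof.
rewrite ge0_fin_numE//; apply: le_lt_trans (ltry D); apply: le_trans AD.
by rewrite (bigD1 i)//= leeDl// sume_ge0.
Qed.

(** If y lies in a cell adjacent to every f l, all squared distances to the x l are at most rho, so
    exp (s (m+1) rho) times the product of Gaussians is at least 1 at y. *)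
Lemma common_nbhd_le m s (f : 'I_m.+1 -> V) (x : nat -> T) : 0 < s ->
  (forall l : 'I_m.+1, A (f l) (x l)) ->
  ((\sum_j a j * \prod_l (e (f l) j)%:R)%:E <=
   (expR (s * m.+1%:R * rho))%:E *
     \int[bl]_y (\prod_(l < m.+1) gauss s (x l) y)%:E)%E.
Proof.
move=> s0 xA; pose b j : R := \prod_l (e (f l) j)%:R.
pose F y := \prod_(l < m.+1) gauss s (x l) y.
have F0 y : 0 <= F y by apply: prodr_ge0 => l _; exact: gauss_ge0.
have mF : measurable_fun setT (EFin \o F) by exact: measurable_prod_gauss.
have bF j y : A j y -> b j <= expR (s * m.+1%:R * rho) * F y.
  move=> yA; rewrite /b /F.
  have -> : expR (s * m.+1%:R * rho) = \prod_(l < m.+1) expR (s * rho).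
    by rewrite prodr_const card_ord -expRM_natl; congr expR; ring.
  rewrite -big_split/=; apply: ler_prod => l _; rewrite ler0n/=.
  case: (boolP (e (f l) j)) => [el|_]; last by rewrite mulr_ge0 ?expR_ge0.
  rewrite /gauss -expRD -expR0 ler_expR.
  suff : 0 <= s * (rho - sqdist (x l) y) by lra.
  by apply: mulr_ge0; [exact: ltW|rewrite subr_ge0 (eA el)].
rewrite -ge0_integralZl//; last by move=> y _; rewrite lee_fin F0.
rewrite -sumEFin.
apply: (@le_trans _ _ (\sum_j \int[bl]_(y in A j)
    ((expR (s * m.+1%:R * rho))%:E * (F y)%:E))%E).
  apply: lee_sum => j _; rewrite EFinM.
  apply: (@le_trans _ _ (bl (A j) * (b j)%:E)%E).
    by rewrite lee_wpmul2r// lee_fin prodr_ge0.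
  rewrite muleC -integral_cst//; apply: ge0_le_integral => //.
  - by move=> y _; rewrite lee_fin prodr_ge0.
  - by apply: measurable_funeM; exact: measurable_funTS.
  - by move=> y yA; rewrite -EFinM lee_fin bF.
have mEF : measurable_fun setT (fun y => (expR (s * m.+1%:R * rho))%:E * (F y)%:E)%E.
  exact: measurable_funeM.
have EF0 y : (0 <= (expR (s * m.+1%:R * rho))%:E * (F y)%:E)%E.
  by rewrite mule_ge0// lee_fin ?expR_ge0.
rewrite -ge0_integral_bigsetU//=.
- apply: ge0_subset_integral => //.
  by apply: bigsetU_measurable => i _; exact: mA.
- exact: index_enum_uniq.
- exact: sub_trivIset tA.
- exact: measurable_funTS.
Qed.

(** The power of a common neighbourhood becomes an integral over a single auxiliary point c, in
    which the points x_l are independent factors. Summing over f then yields the (m+1)-st power of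
    the Gaussian mass g(c) of all cells. *)
Lemma complete_bipartite_count m (sg : R) : 0 < sg ->
  \sum_(f : {ffun 'I_m.+1 -> V}) (\prod_l a (f l)) *
      (\sum_j a j * \prod_l (e (f l) j)%:R) ^+ m.+1 <=
  expR (sg * m.+1%:R * rho) * Num.sqrt (pi / sg) ^+ (d * m.+1) *
  Num.sqrt (sg * m.+1%:R / pi) ^+ d * (Num.sqrt (pi / sg) ^+ (d * m.+1) * D).
Proof.
move=> sg0; have p0 := pi_gt0 R.
set q := Num.sqrt (pi / sg); set q' := Num.sqrt (sg * m.+1%:R / pi).
have q0 : 0 <= q by exact: sqrtr_ge0.
have q'0 : 0 <= q' by exact: sqrtr_ge0.
pose h (f : {ffun 'I_m.+1 -> V}) : R := \sum_j a j * \prod_l (e (f l) j)%:R.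
have h0 f : 0 <= h f by apply: sumr_ge0 => j _; rewrite mulr_ge0 ?prodr_ge0.
set Kc := expR _ * _ * _.
have Kc0 : 0 <= Kc by rewrite !mulr_ge0 ?expR_ge0 ?exprn_ge0.
(* [common_nbhd_le] at the parameter sg / (m+1), raised to the power m+1, equals [Kc] times the
   integral at sg; the factor q'^d of [Kc] cancels the normalisation of that integral. *)
have hx (f : {ffun 'I_m.+1 -> V}) (x : nat -> T) : (forall l : 'I_m.+1, A (f l) (x l)) ->
    (((h f) ^+ m.+1)%:E <= \int[bl]_c (Kc * \prod_(l < m.+1) gauss sg (x l) c)%:E)%E.
  move=> xA; have [W [E1 E2]] := @integral_prod_gauss_pow m sg x sg0.
  under eq_integral do rewrite EFinM.
  rewrite ge0_integralZl ?lee_fin//; last 2 first.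
  - exact: measurable_prod_gauss.
  - by move=> y _; rewrite lee_fin prodr_ge0// => l _; exact: gauss_ge0.
  rewrite E2 -EFinM lee_fin.
  have s0 : 0 < sg / m.+1%:R by rewrite divr_gt0.
  have := common_nbhd_le s0 xA; rewrite E1 -EFinM lee_fin -/(h f).
  set X := (X in _ <= X) => hf; apply: (@le_trans _ _ (X ^+ m.+1)).
    by rewrite lerXn2r ?nnegrE// (le_trans (h0 f) hf).
  rewrite /X le_eqVlt; apply/orP; left; apply/eqP.
  have qq : q' ^+ d * Num.sqrt (pi / (sg * m.+1%:R)) ^+ d = 1.
    rewrite -exprMn -sqrtrM; last by rewrite divr_ge0 ?mulr_ge0 ?ltW.
    rewrite mulf_div [X in _ / X]mulrC divff ?sqrtr1 ?expr1n//.
    by rewrite gt_eqF// !mulr_gt0.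
  rewrite /Kc !exprMn -!expRM_natl -exprM -/q divfK//.
  rewrite mulrA -expRD.
  have -> : expR (sg * m.+1%:R * rho) * q ^+ (d * m.+1) * q' ^+ d *
     (expR (- (sg * W)) * Num.sqrt (pi / (sg * m.+1%:R)) ^+ d) =
     (expR (sg * m.+1%:R * rho) * expR (- (sg * W))) * q ^+ (d * m.+1) *
     (q' ^+ d * Num.sqrt (pi / (sg * m.+1%:R)) ^+ d) by ring.
  rewrite qq mulr1 -expRD; congr (expR _ * _).
  by field.
(* The points x_l are averaged over their cells; [inord] turns f into a sequence indexed by
   [nat]. *)
have hE (f : {ffun 'I_m.+1 -> V}) : ((\prod_l fine (bl (A (f l))) * (h f) ^+ m.+1)%:E <=
    \int[bl]_c (Kc * \prod_l gauss_mass sg (A (f l)) c)%:E)%E.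
  have /= := @gauss_average R d sg (fun l => A (f (inord l))) m.+1 (fun=> Kc)
    ((h f) ^+ m.+1) sg0 (fun=> mA _) (fun=> Afin _).
  move=> hav; apply: le_trans (le_trans _ (hav _ _ _ _)) _ => //.
  - rewrite lee_fin mulrC ler_wpM2l ?exprn_ge0// le_eqVlt; apply/orP; left.
    by apply/eqP; apply: eq_bigr => l _; rewrite inord_val.
  - by rewrite exprn_ge0.
  - move=> x xA; apply: hx => l; have := xA l (ltn_ord l).
    by rewrite inord_val.
  rewrite le_eqVlt; apply/orP; left; apply/eqP; apply: eq_integral => c _.
  by congr (_ * _)%:E; apply: eq_bigr => l _; rewrite inord_val.
pose g c := \sum_i gauss_mass sg (A i) c.
have g0 c : 0 <= g c by apply: sumr_ge0 => i _; exact: gauss_mass_ge0.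
have mg : measurable_fun setT g.
  by apply: measurable_sum => i; exact: measurable_gauss_mass.
have gE c : (g c)%:E = (\int[bl]_(x in \big[setU/set0]_i A i) (gauss sg x c)%:E)%E.
  rewrite ge0_integral_bigsetU//=; last 4 first.
  - exact: index_enum_uniq.
  - exact: sub_trivIset tA.
  - apply: measurable_funTS; apply/measurable_EFinP; exact: measurable_gaussl.
  - by move=> x _; rewrite lee_fin gauss_ge0.
  by rewrite /g -sumEFin; apply: eq_bigr => i _; rewrite gauss_massE.
have gq c : g c <= q ^+ d.
  rewrite -lee_fin gE; apply: gauss_integral_le => //.
  by apply: bigsetU_measurable => i _; exact: mA.
have int_g : (\int[bl]_c (g c)%:E <= (q ^+ d * D)%:E)%E.
  rewrite /g; under eq_integral do rewrite -sumEFin.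
  rewrite ge0_integral_sum//; last 2 first.
  - by move=> i; apply/measurable_EFinP; exact: measurable_gauss_mass.
  - by move=> i c _; rewrite lee_fin gauss_mass_ge0.
  under eq_bigr do rewrite integral_gauss_mass//.
  rewrite -ge0_sume_distrr//.
  by rewrite EFinM lee_wpmul2l// lee_fin exprn_ge0.
rewrite -lee_fin -sumEFin.
apply: (@le_trans _ _ (\sum_(f : {ffun 'I_m.+1 -> V})
   \int[bl]_c (Kc * \prod_l gauss_mass sg (A (f l)) c)%:E)%E).
  apply: lee_sum => f _; apply: le_trans (hE f); rewrite lee_fin.
  rewrite -/(h f); apply: ler_wpM2r; first by rewrite exprn_ge0.
  apply: ler_prod => l _; rewrite a_ge0/=.
  by rewrite -lee_fin fineK.
rewrite -ge0_integral_sum//; last 2 first.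
- move=> f; apply/measurable_EFinP; apply: measurable_funM => //.
  by apply: measurable_prod => l _; exact: measurable_gauss_mass.
- move=> f c _; rewrite lee_fin mulr_ge0// prodr_ge0// => l _.
  exact: gauss_mass_ge0.
have E c : (\sum_(f : {ffun 'I_m.+1 -> V})
    (Kc * \prod_l gauss_mass sg (A (f l)) c)%:E)%E = (Kc * g c ^+ m.+1)%:E.
  rewrite sumEFin -mulr_sumr; congr (_ * _)%:E.
  have -> : g c ^+ m.+1 = \prod_(l < m.+1) g c by rewrite prodr_const card_ord.
  by rewrite /g bigA_distr_bigA.
under eq_integral do rewrite E.
(* Of the m+1 factors g, m are bounded by q^d and the last one is integrated, giving q^d D. *)
apply: (@le_trans _ _ (\int[bl]_c ((Kc * q ^+ (d * m))%:E * (g c)%:E))%E).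
  apply: ge0_le_integral => //.
  - by move=> c _; rewrite lee_fin mulr_ge0// exprn_ge0.
  - by apply/measurable_EFinP; apply: measurable_funM => //; exact: measurable_funX.
  - by apply: measurable_funeM; exact/measurable_EFinP.
  - move=> c _; rewrite -EFinM lee_fin -[leRHS]mulrA ler_wpM2l// exprSr ler_wpM2r//.
    by rewrite exprM lerXn2r ?nnegrE ?exprn_ge0.
rewrite ge0_integralZl//; last 3 first.
- exact/measurable_EFinP.
- by move=> c _; rewrite lee_fin.
- by rewrite lee_fin mulr_ge0// exprn_ge0.
apply: (@le_trans _ _ ((Kc * q ^+ (d * m))%:E * (q ^+ d * D)%:E)%E).
  by rewrite lee_wpmul2l// lee_fin mulr_ge0// exprn_ge0.
by rewrite -EFinM lee_fin mulnS exprD; lra.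
Qed.

End complete_bipartite_count.

(** * Partitions of bounded sets into small cells *)

Section grid.
Context {R : realType} (d : nat).
Local Notation T := (d.-tuple R).
Local Notation bl := (@borel_lebesgue R d).

(** The cells are not cut down to A, so they are Borel even if A is only Lebesgue measurable. A
    point of a cell later serves as the centre of a ball containing its neighbourhood. *)
Record fine_partition (A : set T) (eta : R) := FinePartition {
  cell_index : finType;
  cell : cell_index -> set T;
  measurable_cell : forall i, measurable (cell i);
  trivIset_cell : trivIset setT cell;
  cell_neq0 : forall i, cell i !=set0;
  cell_cover : forall x, A x -> exists i, cell i x;
  cell_diam : forall i x y, cell i x -> cell i y -> sqdist x y <= eta }.

Lemma fine_partition_bounded (A : set T) (eta : R) : eucl_bounded A -> 0 < eta ->
  inhabited (fine_partition A eta).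
Proof.
move=> [M0 AM0] eta0; pose M := `|M0|.
have AM x : A x -> sqdist (origin d) x <= M ^+ 2.
  move=> /AM0 xM; rewrite -eucl_dist_leE ?normr_ge0//.
  exact: le_trans xM (ler_norm M0).
(* A cube of side h has squared diameter at most d h^2 <= eta; [d.+1] keeps h positive for d = 0. *)
pose h := Num.sqrt (eta / d.+1%:R).
have h0 : 0 < h by rewrite sqrtr_gt0 divr_gt0.
(* The successor lets the half-open cubes reach the coordinate M as well. *)
pose N := (Num.truncn (2 * M / h)).+1.
pose C (i : {ffun 'I_d -> 'I_N}) : set T :=
  \bigcap_(l in setT) [set x : T | tnth x l \in `[h * (i l)%:R - M, h * (i l).+1%:R - M[ ].
have CE i x : C i x <-> forall l, h * (i l)%:R - M <= tnth x l < h * (i l).+1%:R - M.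
  split=> [Cx l|h1 l _]; first by have := Cx l I; rewrite /= in_itv.
  by rewrite /= in_itv/=; exact: h1.
have uniq_idx (y : R) (a b : nat) : h * a%:R <= y -> y < h * b.+1%:R -> (a <= b)%N.
  move=> h1 h2; have := le_lt_trans h1 h2.
  by rewrite ltr_pM2l// ltr_nat ltnS.
constructor; apply: (@FinePartition _ _ {ffun 'I_d -> 'I_N} C).
- move=> i; apply: fin_bigcap_measurable; first exact: finite_finset.
  move=> l _; rewrite -[X in measurable X]setTI.
  exact: (@measurable_tnth _ R d l measurableT `[h * (i l)%:R - M, h * (i l).+1%:R - M[%classic).
- move=> i j _ _ [x [/CE xi /CE xj]]; apply/ffunP => l; apply/val_inj.
  have /andP[i1 i2] := xi l; have /andP[j1 j2] := xj l.
  apply/eqP; rewrite eqn_leq; apply/andP; split.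
    by apply: (@uniq_idx (tnth x l + M)); lra.
  by apply: (@uniq_idx (tnth x l + M)); lra.
- move=> i; exists [tuple h * (i l)%:R - M | l < d]; apply/CE => l.
  by rewrite tnth_mktuple lexx ltrD2r ltr_pM2l// ltr_nat ltnSn.
- move=> x Ax.
  have xM l : - M <= tnth x l <= M.
    rewrite -ler_norml.
    suff : `|tnth x l| ^+ 2 <= M ^+ 2 by rewrite ler_pXn2r ?nnegrE ?normr_ge0.
    rewrite real_normK ?num_real//; apply: le_trans (AM x Ax).
    rewrite /sqdist (bigD1 l)//= tnth_mktuple sub0r sqrrN.
    by rewrite lerDl sumr_ge0// => j _; exact: sqr_ge0.
  pose u l := (tnth x l + M) / h.
  have u0 l : 0 <= u l by apply: divr_ge0; [have := xM l; lra|exact: ltW].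
  exists [ffun l => inord (Num.truncn (u l))]; apply/CE => l; rewrite ffunE.
  have /andP[t1 t2] := truncn_itv (u0 l).
  rewrite inordK; last first.
    rewrite ltnS; apply: le_truncn; rewrite ler_pM2r ?invr_gt0//; have := xM l; lra.
  move: t1 t2; rewrite /u ler_pdivlMr// ltr_pdivrMr// => t1 t2.
  by rewrite [h * _]mulrC [h * _.+1%:R]mulrC; apply/andP; split; lra.
- move=> i x y /CE xi /CE yi; apply: (@le_trans _ _ (\sum_(l < d) h ^+ 2)).
    apply: ler_sum => l _; rewrite -real_normK ?num_real//.
    have xyh : `|tnth x l - tnth y l| <= h.
      have := xi l; have := yi l; rewrite -natr1 => /andP[? ?] /andP[? ?].
      by rewrite ler_norml; apply/andP; split; lra.
    by rewrite lerXn2r ?nnegrE// ltW.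
  rewrite sumr_const card_ord sqr_sqrtr; last by rewrite divr_ge0// ltW.
  rewrite -[_ *+ d]mulr_natl mulrCA.
  by rewrite ger_pMr// ler_pdivrMr// mul1r ler_nat.
Qed.

(* A Cauchy-Schwarz-free substitute for the triangle inequality. *)
Lemma sqdist_perturb (x x' y y' : T) (eta : R) : 0 < eta -> eta <= 1 ->
  sqdist x x' <= eta ^+ 2 -> sqdist y y' <= eta ^+ 2 ->
  sqdist x' y' <= sqdist x y + eta * (sqdist x y + 8).
Proof.
move=> e0 e1 hx hy.
have : sqdist x' y' <= (1 + eta) * sqdist x y +
    (1 + eta^-1) * (2 * sqdist x x' + 2 * sqdist y y').
  rewrite /sqdist !mulr_sumr -big_split/= mulr_sumr -big_split/=.
  apply: ler_sum => i _.
  set a := tnth x i; set b := tnth y i; set a' := tnth x' i; set b' := tnth y' i.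
  pose u := a - b; pose v := (a' - a) - (b' - b).
  have -> : a' - b' = u + v by rewrite /u /v; ring.
  rewrite -/u.
  have h1 : (u + v) ^+ 2 <= (1 + eta) * u ^+ 2 + (1 + eta^-1) * v ^+ 2.
    have : 0 <= eta * (u - eta^-1 * v) ^+ 2 by rewrite mulr_ge0 ?sqr_ge0 ?ltW.
    have -> : eta * (u - eta^-1 * v) ^+ 2 = eta * u ^+ 2 - 2 * u * v + eta^-1 * v ^+ 2.
      by field; rewrite gt_eqF.
    lra.
  apply: (le_trans h1); rewrite lerD2l; apply: ler_wpM2l.
    by rewrite addr_ge0// invr_ge0 ltW.
  have : 0 <= (a' - a + (b' - b)) ^+ 2 by exact: sqr_ge0.
  rewrite /v; lra.
move=> /le_trans; apply.
have : (1 + eta^-1) * (2 * sqdist x x' + 2 * sqdist y y') <= (1 + eta^-1) * (4 * eta ^+ 2).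
  by apply: ler_wpM2l; [rewrite addr_ge0// invr_ge0 ltW|lra].
have -> : (1 + eta^-1) * (4 * eta ^+ 2) = 4 * eta * eta + 4 * eta.
  by field; rewrite gt_eqF.
have : eta * eta <= eta by rewrite ger_pMr.
lra.
Qed.

End grid.

(** * Volumes restricted to a bounded Lebesgue measurable set *)

Lemma measure_bigcup_finType (R : realType) (dd : measure_display)
    (X : measurableType dd) (mu : {measure set X -> \bar R}) (V : finType)
    (P : {pred V}) (F : V -> set X) :
  (forall i, measurable (F i)) -> trivIset setT F ->
  mu (\bigcup_(i in [set` P]) F i) = (\sum_(i | P i) mu (F i))%E.
Proof.
move=> mF tF; rewrite measure_fin_bigcup//; last exact: sub_trivIset tF.
rewrite -(@bigfs _ _ _ _ (index_enum V)) ?index_enum_uniq//.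
by move=> i _; rewrite mem_index_enum.
Qed.

Section restricted_volume.
Context {R : realType} (d : nat).
Local Notation T := (d.-tuple R).
Local Notation bl := (@borel_lebesgue R d).
Variable S : set T.
Hypotheses (bS : eucl_bounded S) (mS : lebesgue_measurable S).

Lemma vol_ge0 (A : set T) : (0 <= vol A)%E. Proof. exact: mu_ext_ge0. Qed.

Lemma le_vol (A B : set T) : A `<=` B -> (vol A <= vol B)%E.
Proof. exact: le_mu_ext. Qed.

Lemma vol_bounded_fin : vol S \is a fin_num.
Proof.
have [M SM] := bS; rewrite ge0_fin_numE ?vol_ge0//.
have SM' : S `<=` eucl_ball (origin d) `|M|.
  by move=> x /SM h; apply: le_trans h (ler_norm M).
apply: le_lt_trans (le_vol SM') _; rewrite vol_borelE; last exact: measurable_eucl_ball.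
by rewrite ltey_eq borel_lebesgue_ball_fin.
Qed.

Lemma vol_setI_fin (A : set T) : vol (A `&` S) \is a fin_num.
Proof.
have := vol_bounded_fin; rewrite !ge0_fin_numE ?vol_ge0//.
by apply: le_lt_trans; apply: le_vol; exact: subIsetr.
Qed.

Lemma vol_setI_le (A : set T) : measurable A -> (vol (A `&` S) <= bl A)%E.
Proof. by move=> mA; rewrite -vol_borelE//; apply: le_vol; exact: subIsetl. Qed.

Lemma sum_vol_cells (eta : R) (F : fine_partition S eta) :
  \sum_i fine (vol (@cell _ _ _ _ F i `&` S)) = fine (vol S).
Proof.
apply: EFin_inj; rewrite -sumEFin fineK ?vol_bounded_fin//.
under eq_bigr do rewrite fineK ?vol_setI_fin//.
pose m := @completed_measure_extension _ _ _ bl.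
(* The type places these sets in the completed sigma-algebra, where they are measurable and [vol] is
   additive. *)
pose F' i : set (caratheodory_type bl^*%mu) := @cell _ _ _ _ F i `&` S.
have mF i : measurable (F' i).
  apply: measurableI; last exact: mS.
  apply: caratheodory_measurable_mu_ext; exact: measurable_cell.
have tF : trivIset setT F'.
  move=> i j _ _ [x [[ix _] [jx _]]].
  by apply: (@trivIset_cell _ _ _ _ F i j I I); exists x.
rewrite -[LHS](measure_bigcup_finType m predT mF tF); congr (vol _).
apply/seteqP; split => [x [i _ []]//|x Sx].
by have [i Fx] := cell_cover F Sx; exists i.
Qed.

End restricted_volume.

(** * Comparison of the hard sphere model with the graph model *)

Section discretisation.
Context {R : realType} (d : nat).
Local Notation T := (d.-tuple R).
Variables (S : set T) (lam : R).
Hypotheses (bS : eucl_bounded S) (mS : lebesgue_measurable S) (lam_gt0 : 0 < lam).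
Context (dd : measure_display) (O : measurableType dd) (P : probability O R).
Variable X : O -> {fset T}.
Hypothesis HX : poisson_process P S lam X.
Local Notation r := (unit_volume_radius R d).
Hypothesis r_gt0 : 0 < r.
Local Notation rho := ((2 * r) ^+ 2).

(** Requiring all pairs of points to conflict makes the approximating event contain the hard-core
    event, and keeps the neighbourhood of a cell inside a ball of radius 2 r. *)
Definition adj eta (F : fine_partition S eta) : rel (cell_index F) :=
  fun i j => `[< forall x y, cell i x -> cell j y -> sqdist x y < rho >].

Definition cell_mass eta (F : fine_partition S eta) (i : cell_index F) : R :=
  fine (vol (cell i `&` S)).

Definition cell_event eta (F : fine_partition S eta) (I : {set cell_index F}) : set O :=
  [set w | forall i, npoints (cell i) (X w) = (i \in I)].

Definition hard_core_approx eta (F : fine_partition S eta) : set O :=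
  \bigcup_(I in [set` stable (@adj eta F)]) cell_event I.

Lemma adj_sym eta (F : fine_partition S eta) : symmetric (@adj eta F).
Proof.
move=> i j; apply/asboolP/asboolP => h x y xi yj; rewrite sqdistC; exact: h.
Qed.

Lemma adj_refl eta (F : fine_partition S eta) : eta < rho -> reflexive (@adj eta F).
Proof.
by move=> er i; apply/asboolP => x y xi yi; exact: le_lt_trans (cell_diam xi yi) er.
Qed.

Lemma cell_mass_ge0 eta (F : fine_partition S eta) i : 0 <= @cell_mass eta F i.
Proof. by apply: fine_ge0; exact: vol_ge0. Qed.

Lemma poisson_prob_bool (x : R) (b : bool) : 0 <= x ->
  poisson_prob x 0%N [set nat_of_bool b] = (expR (- x) * (if b then x else 1))%:E.
Proof.
rewrite le_eqVlt => /orP[/eqP <-|x0]; rewrite /poisson_prob.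
  rewrite ltxx oppr0 expR0 mul1r diracE.
  by case: b; [rewrite memNset//|rewrite mem_set].
rewrite x0 esum_set1; last by rewrite lee_fin poisson_pmf_ge0.
rewrite /poisson_pmf x0; congr EFin.
by case: b; rewrite ?expr1 ?expr0 ?invr1 ?divr1 ?mulr1 mulrC ?mulr1.
Qed.

(** For each cell, the Poisson probabilities of one point and of none have ratio lam mu_i, and the
    cells are independent: this produces the weights of the graph model. *)
Lemma prob_cell_event eta (F : fine_partition S eta) (I : {set cell_index F}) :
  P (cell_event I) =
  (expR (- (lam * fine (vol S))) * weight (@cell_mass eta F) lam I)%:E.
Proof.
have [_ _ hpois hind] := HX.
pose A (k : 'I_#|cell_index F|) := @cell _ _ _ _ F (enum_val k).
pose B (k : 'I_#|cell_index F|) := [set nat_of_bool (enum_val k \in I)].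
have := hind _ A B.
have -> : [set w | forall k, B k (npoints (A k) (X w))] = cell_event I.
  apply/seteqP; split => w /= h i; last exact: h.
  by have := h (enum_rank i); rewrite /A /B/= enum_rankK.
move=> ->; last 2 first.
- by move=> k; exact: measurable_cell.
- move=> k l _ _ kl; apply: enum_val_inj.
  exact: (@trivIset_cell _ _ _ _ F _ _ Logic.I Logic.I kl).
have pk k : P [set w | B k (npoints (A k) (X w))] =
   (expR (- (lam * cell_mass (enum_val k))) *
    (if enum_val k \in I then lam * cell_mass (enum_val k) else 1))%:E.
  rewrite hpois; last exact: measurable_cell.
  by rewrite poisson_prob_bool// mulr_ge0 ?cell_mass_ge0// ltW.
under eq_bigr do rewrite pk.
rewrite prodEFin; congr EFin.
rewrite -(sum_vol_cells bS mS F) mulr_sumr -sumrN expR_sum /weight big_split/=.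
congr (_ * _).
  by rewrite [RHS](reindex (@enum_val _ (cell_index F)))//=; exact/onW_bij/enum_val_bij.
rewrite [RHS]big_mkcond/= [RHS](reindex (@enum_val _ (cell_index F)))//=.
exact/onW_bij/enum_val_bij.
Qed.

Lemma measurable_cell_event eta (F : fine_partition S eta) (I : {set cell_index F}) :
  measurable (cell_event I).
Proof.
have [_ hm _ _] := HX.
rewrite (_ : cell_event I = \bigcap_(i in setT)
    [set w | npoints (@cell _ _ _ _ F i) (X w) = (i \in I)]); last first.
  by apply/seteqP; split => w h i; [move=> _; exact: h|exact: (h i Logic.I)].
apply: fin_bigcap_measurable; first exact: finite_finset.
by move=> i _; apply: hm; exact: measurable_cell.
Qed.

Lemma trivIset_cell_event eta (F : fine_partition S eta) :
  trivIset setT (@cell_event eta F).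
Proof.
move=> I J _ _ [w [hI hJ]]; apply/finset.setP => i.
by have := hI i; rewrite (hJ i); do 2 case: (_ \in _).
Qed.

Lemma npoints_sum (A : set T) (Y : {fset T}) :
  npoints A Y = \sum_(x <- Y) (x \in A : nat).
Proof.
rewrite /npoints card_fset_sum1 big_fset/= big_mkcond/=.
by apply: eq_bigr => x _; case: (x \in A).
Qed.

Lemma npoints_gt0 (A : set T) (Y : {fset T}) x : x \in Y -> A x ->
  (0 < npoints A Y)%N.
Proof.
by move=> xY Ax; rewrite /npoints cardfs_gt0; apply/fset0Pn; exists x;
  rewrite !inE/= xY mem_set.
Qed.

Lemma npoints_gt1 (A : set T) (Y : {fset T}) x y :
  x \in Y -> y \in Y -> x != y -> A x -> A y -> (1 < npoints A Y)%N.
Proof.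
move=> xY yY xy Ax Ay; rewrite /npoints.
have -> : 2%N = #|` [fset x; y]%fset| by rewrite cardfs2 xy.
apply: fsubset_leq_card; apply/fsubsetP => z; rewrite !inE => /orP[]/eqP->/=.
  by rewrite xY mem_set.
by rewrite yY mem_set.
Qed.

Lemma npoints_gt1P (A : set T) (Y : {fset T}) : (1 < npoints A Y)%N ->
  exists x y, [/\ x \in Y, y \in Y, x != y, A x & A y].
Proof.
rewrite /npoints; set Z := [fset x in Y | x \in A]%fset => n1.
have : (0 < #|` Z|)%N by exact: ltn_trans n1.
rewrite cardfs_gt0 => /fset0Pn[x xZ].
have : (0 < #|` (Z `\ x)%fset|)%N.
  by move: n1; rewrite (cardfsD1 x) xZ add1n ltnS.
rewrite cardfs_gt0 => /fset0Pn[y]; rewrite in_fsetD1 => /andP[yx].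
move: xZ; rewrite !inE/= => /andP[xY /set_mem xA] /andP[yY /set_mem yA].
by exists x, y; split => //; rewrite eq_sym.
Qed.

Lemma card_sum_npoints eta (F : fine_partition S eta) w :
  #|` X w| = (\sum_i npoints (@cell _ _ _ _ F i) (X w))%N.
Proof.
have [XS _ _ _] := HX.
under eq_bigr do rewrite npoints_sum.
rewrite exchange_big/= card_fset_sum1; apply: eq_big_seq => x xX.
have [i xi] := cell_cover F (XS _ _ xX).
rewrite (bigD1 i)//= mem_set// big1// => j ji.
rewrite memNset// => xj; move/eqP : ji; apply.
by apply: (@trivIset_cell _ _ _ _ F _ _ Logic.I Logic.I); exists x.
Qed.

Lemma card_cell_event eta (F : fine_partition S eta) (I : {set cell_index F}) w :
  cell_event I w -> #|` X w| = #|I|.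
Proof.
move=> hI; rewrite (card_sum_npoints F).
under eq_bigr do rewrite hI.
by rewrite -sum1_card [RHS]big_mkcond/=; apply: eq_bigr => i _; case: (i \in I).
Qed.

(** For eta < rho, two points in one cell conflict, so cells hold at most one point, and points in
    adjacent cells conflict by definition. *)
Lemma hard_core_sub_approx eta (F : fine_partition S eta) : eta < rho ->
  hard_core X `<=` hard_core_approx F.
Proof.
move=> er w hc; exists [set i | (0 < npoints (@cell _ _ _ _ F i) (X w))%N]%SET.
  have pick i : (0 < npoints (@cell _ _ _ _ F i) (X w))%N ->
      exists2 x, x \in X w & cell i x.
    rewrite /npoints cardfs_gt0 => /fset0Pn[x]; rewrite !inE/= => /andP[xX xi].
    by exists x => //; exact: set_mem.
  apply/stableP => i j; rewrite !inE => /pick[x xX xi] /pick[y yX yj] /asboolP aij.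
  apply: (@trivIset_cell _ _ _ _ F _ _ Logic.I Logic.I); exists x; split => //.
  have [->//|xy] := eqVneq x y.
  have := hc x y xX yX xy; rewrite leNgt eucl_dist_ltE ?mulr_ge0 ?(ltW r_gt0)//.
  by rewrite aij.
move=> i; rewrite inE; set n := npoints _ _.
suff : (n <= 1)%N by case: n => [|[]].
rewrite leqNgt; apply/negP => n1.
have [x [y [xX yX xy xi yi]]] := npoints_gt1P n1.
have := hc x y xX yX xy; rewrite leNgt eucl_dist_ltE ?mulr_ge0 ?(ltW r_gt0)//.
by rewrite (le_lt_trans (cell_diam xi yi)).
Qed.

(** If the bound failed, [sqdist_perturb] would make the cells of x and y adjacent, hence equal by
    stability, and this cell would hold two points. *)
Lemma hard_core_approx_dist eta (F : fine_partition S (eta ^+ 2)) w x y :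
  0 < eta -> eta <= 1 -> hard_core_approx F w ->
  x \in X w -> y \in X w -> x != y ->
  rho <= sqdist x y + eta * (sqdist x y + 8).
Proof.
move=> e0 e1 [I /= sI hI] xX yX xy; rewrite leNgt; apply/negP => hr.
have [XS _ _ _] := HX.
have [i xi] := cell_cover F (XS _ _ xX); have [j yj] := cell_cover F (XS _ _ yX).
have inI k z : z \in X w -> cell k z -> k \in I.
  by move=> zX /(npoints_gt0 zX); rewrite hI; case: (k \in I).
have /stableP/(_ i j (inI _ _ xX xi) (inI _ _ yX yj)) := sI.
have aij : adj i j.
  apply/asboolP => x' y' xi' yj'; apply: le_lt_trans hr.
  exact: sqdist_perturb (cell_diam xi xi') (cell_diam yj yj').
move=> /(_ aij) ij; rewrite -ij in yj.
by have := npoints_gt1 xX yX xy xi yj; rewrite hI; case: (_ \in _).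
Qed.

Lemma hard_core_approxE eta (F : fine_partition S eta) (phi : nat -> R) w :
  (phi #|` X w| * \1_(hard_core_approx F) w)%:E =
    (\sum_(I : {set cell_index F} | (I \subset [set: cell_index F]%SET) && stable (@adj eta F) I)
    (phi #|I|)%:E * (\1_(cell_event I) w)%:E)%E.
Proof.
rewrite indicE; case: (boolP (w \in hard_core_approx F)) => [|wF].
  move=> /set_mem[I sI hI]; rewrite (bigD1 I) ?finset.subsetT ?sI//=.
  rewrite indicE mem_set// mulr1 mule1 big1 ?adde0 ?(card_cell_event hI)//.
  move=> J /andP[_ JI]; rewrite indicE memNset ?mule0// => hJ.
  by move/eqP : JI; apply; apply: (@trivIset_cell_event eta F) => //; exists w.
rewrite mulr0 big1// => I /andP[_ sI]; rewrite indicE memNset ?mule0// => hI.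
by move/negP : wF; apply; apply/mem_set; exists I.
Qed.

Lemma measurable_hard_core_approx eta (F : fine_partition S eta) (phi : nat -> R) :
  measurable_fun setT (fun w => (phi #|` X w| * \1_(hard_core_approx F) w)%:E).
Proof.
under eq_fun do rewrite hard_core_approxE -big_filter.
apply: emeasurable_sum => I; apply: measurable_funeM; apply/measurable_EFinP.
by apply: measurable_indic; exact: measurable_cell_event.
Qed.

(** For phi constant 1 or the identity, the sum is [partition_fun] or [occupation], with the same
    prefactor. *)
Lemma integral_hard_core_approx eta (F : fine_partition S eta) (phi : nat -> R) :
  (forall n, 0 <= phi n) ->
  (\int[P]_w (phi #|` X w| * \1_(hard_core_approx F) w)%:E =
   (expR (- (lam * fine (vol S))) *
     \sum_(I : {set cell_index F} | (I \subset [set: cell_index F]%SET) && stable (@adj eta F) I)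
       phi #|I| * weight (@cell_mass eta F) lam I)%:E)%E.
Proof.
move=> phi0.
under eq_integral do rewrite hard_core_approxE -big_filter.
have mi (I : {set cell_index F}) :
    measurable_fun setT (fun w => (phi #|I|)%:E * (\1_(@cell_event eta F I) w)%:E)%E.
  apply: measurable_funeM; apply/measurable_EFinP.
  by apply: measurable_indic; exact: measurable_cell_event.
rewrite ge0_integral_sum//; last first.
  by move=> I w _; rewrite mule_ge0// lee_fin// indicE.
rewrite big_filter mulr_sumr -sumEFin; apply: eq_bigr => I _.
rewrite ge0_integralZl ?lee_fin//; last first.
  by apply/measurable_EFinP; apply: measurable_indic; exact: measurable_cell_event.
rewrite integral_indic//; last exact: measurable_cell_event.
by rewrite setIT -[X in (_ * X)%E]/(P (cell_event I)) prob_cell_event -EFinM mulrCA.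
Qed.

Let rho_gt0 : 0 < rho. Proof. by rewrite exprn_gt0// mulr_gt0. Qed.

(** Chosen so that eta0 (rho + 8) = rho / 4 and eta0^2 < rho / 4: then no configuration of any later
    approximation has two points in one cell of mesh eta0. *)
Let eta0 : R := rho / (4 * (rho + 8)).

Let eta_ k : R := eta0 / k.+1%:R.

Let eta0_gt0 : 0 < eta0.
Proof. by rewrite divr_gt0// mulr_gt0// addr_gt0. Qed.

Let eta0_rho : eta0 * (rho + 8) = rho / 4.
Proof. by have r0 := rho_gt0; rewrite /eta0; field; apply/eqP; lra. Qed.

Let eta0_le1 : eta0 <= 1.
Proof.
have r0 := rho_gt0; rewrite ler_pdivrMr ?mulr_gt0 ?addr_gt0// mul1r; lra.
Qed.

Let eta0_sqr : eta0 ^+ 2 < rho / 4.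
Proof.
have : eta0 * eta0 <= eta0 by rewrite ger_pMr.
have : 0 <= eta0 * rho by rewrite mulr_ge0// ltW.
have := eta0_rho; have := eta0_gt0; rewrite expr2; lra.
Qed.

Let eta_gt0 k : 0 < eta_ k. Proof. by rewrite divr_gt0. Qed.

Let eta_le k : eta_ k <= eta0.
Proof. by rewrite ler_pdivrMr// ler_peMr ?(ltW eta0_gt0)// ler1n. Qed.

Let eta_sqr k : eta_ k ^+ 2 < rho.
Proof.
have : eta_ k ^+ 2 <= eta0 ^+ 2.
  by rewrite lerXn2r ?nnegrE ?(ltW (eta_gt0 k)) ?(ltW eta0_gt0)// eta_le.
by have := eta0_sqr; have := rho_gt0; lra.
Qed.

Let ex_part k : exists F : fine_partition S (eta_ k ^+ 2), True.
Proof.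
by have [F] := fine_partition_bounded bS (exprn_gt0 2 (eta_gt0 k)); exists F.
Qed.

Let F_ k : fine_partition S (eta_ k ^+ 2) := sval (cid (ex_part k)).

(** A bound uniform in k, needed for dominated convergence: each cell of the coarsest partition
    holds at most one point. *)
Let card_bound k w : hard_core_approx (F_ k) w ->
  (#|` X w| <= #|cell_index (F_ 0)|)%N.
Proof.
move=> hw; rewrite (card_sum_npoints (F_ 0)) -sum1_card; apply: leq_sum => i _.
rewrite leqNgt; apply/negP => /npoints_gt1P[x [y [xX yX xy xi yi]]].
have h1 := cell_diam xi yi.
have h2 := hard_core_approx_dist (eta_gt0 k) (le_trans (eta_le k) eta0_le1) hw xX yX xy.
have h3 : eta_ 0 ^+ 2 <= eta0 ^+ 2 by rewrite /eta_ divr1.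
have s0 := sqdist_ge0 x y.
have h4 : eta_ k * (sqdist x y + 8) <= eta0 * (rho + 8).
  by apply: ler_pM => //; [exact: ltW|lra|have := eta0_sqr; have := rho_gt0; lra].
by have := eta0_sqr; have := rho_gt0; have := eta0_rho; lra.
Qed.

(** Hard-core configurations lie in every approximation, and a pair that is too close is detected by
    all sufficiently fine ones. *)
Let indic_cvg w :
  (\1_(hard_core_approx (F_ k)) w : R) @[k --> \oo] --> (\1_(hard_core X) w : R).
Proof.
rewrite !indicE; case: (boolP (w \in hard_core X)) => [/set_mem hw|hw].
  rewrite (_ : (fun k => _) = fun=> 1); first exact: cvg_cst.
  by apply/funext => k; rewrite indicE mem_set//; exact: hard_core_sub_approx.
have [x [y [xX yX xy sxy]]] : exists x y,
    [/\ x \in X w, y \in X w, x != y & sqdist x y < rho].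
  apply: contrapT => h; move/negP : hw; apply; apply/mem_set => x y xX yX xy.
  rewrite leNgt eucl_dist_ltE ?mulr_ge0 ?(ltW r_gt0)//; apply/negP => sxy.
  by apply: h; exists x, y.
have s0 := sqdist_ge0 x y.
(* For k >= N this gives eta_k (q + 8) < rho - q, where q = sqdist x y. *)
have [N hN] : exists N : nat, eta0 * (sqdist x y + 8) / (rho - sqdist x y) < N%:R.
  exists (Num.truncn (eta0 * (sqdist x y + 8) / (rho - sqdist x y))).+1.
  exact: truncnS_gt.
apply: cvg_near_cst; exists N => // k /= Nk; rewrite indicE memNset// => hk.
have := hard_core_approx_dist (eta_gt0 k) (le_trans (eta_le k) eta0_le1) hk xX yX xy.
rewrite leNgt => /negP; apply.
rewrite -ltrBrDl /eta_ mulrAC ltr_pdivrMr// -ltr_pdivrMl ?subr_gt0// mulrC.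
by apply: lt_trans hN _; rewrite ltr_nat ltnS.
Qed.

(** Dominated convergence; by [card_bound] the constant M, a sum of nonnegative values of phi,
    dominates all the integrands. *)
Lemma integral_hard_core_cvg (phi : nat -> R) : (forall n, 0 <= phi n) ->
  (\int[P]_(w in hard_core X) (phi #|` X w|)%:E \is a fin_num /\
  \int[P]_w (phi #|` X w| * \1_(hard_core_approx (F_ k)) w)%:E @[k --> \oo] -->
   \int[P]_(w in hard_core X) (phi #|` X w|)%:E)%E.
Proof.
move=> phi0; pose M := \sum_(n < #|cell_index (F_ 0)|.+1) phi n.
rewrite integral_mkcond.
rewrite (_ : _ \_ _ = fun w => (phi #|` X w| * \1_(hard_core X) w)%:E); last first.
  apply/funext => w; rewrite patchE indicE.
  by case: ifPn => _; rewrite ?mulr1 ?mulr0.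
pose f_ k w := (phi #|` X w| * \1_(hard_core_approx (F_ k)) w)%:E.
pose f w := (phi #|` X w| * \1_(hard_core X) w)%:E.
have mf_ k : measurable_fun setT (f_ k) by exact: measurable_hard_core_approx.
have f_f w : [set: O] w -> f_ ^~ w @ \oo --> f w.
  move=> _; apply: cvg_EFin; first exact: nearW.
  by apply: cvgMr; exact: indic_cvg.
have ig : P.-integrable setT (cst M%:E) by exact: finite_measure_integrable_cst.
have f_g k w : [set: O] w -> (`|f_ k w| <= cst M%:E w)%E.
  move=> _ /=; rewrite lee_fin normrM [X in _ * X]ger0_norm ?indicE//.
  rewrite ger0_norm//; case: (boolP (w \in _)) => [/set_mem/card_bound hB|_].
    rewrite mulr1 /M -ltnS in hB *.
    by rewrite (bigD1 (Ordinal hB))//= lerDl sumr_ge0.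
  by rewrite mulr0 sumr_ge0.
have mf : measurable_fun setT f by exact: (emeasurable_fun_cvg f_).
have ae_f : {ae P, forall w, [set: O] w -> f_ ^~ w @ \oo --> f w} by exact: aeW.
have ae_g : {ae P, forall w k, [set: O] w -> (`|f_ k w| <= cst M%:E w)%E}.
  by apply: aeW => w k; exact: f_g.
have [intf _ cf] := dominated_convergence measurableT mf_ mf ae_f ig ae_g.
by split; [exact: integrable_fin_num|exact: cf].
Qed.

(** By [indic_cvg] the event is the intersection of its approximations, each a finite union of cell
    events. *)
Lemma measurable_hard_core : measurable (hard_core X).
Proof.
rewrite (_ : hard_core X = \bigcap_k hard_core_approx (F_ k)).
  apply: bigcap_measurableType => k _; apply: fin_bigcup_measurable.
    exact: finite_finset.
  by move=> I _; exact: measurable_cell_event.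
apply/seteqP; split => w hw; first by move=> k _; exact: hard_core_sub_approx.
have := @indic_cvg w.
rewrite (_ : (fun k => _) = fun=> 1); last first.
  by apply/funext => k; rewrite indicE mem_set//; exact: hw.
move=> /(cvg_lim (@Rhausdorff R)); rewrite lim_cst//.
rewrite indicE; case: (boolP (w \in hard_core X)) => [/set_mem//|_ /eqP].
by rewrite oner_eq0.
Qed.

(** The empty configuration is hard-core and has positive probability. *)
Lemma hard_core_gt0 : 0 < fine (P (hard_core X)).
Proof.
have [_ hm hpois _] := HX; have mH := measurable_hard_core.
rewrite fine_gt0//; apply/andP; split; last by rewrite ltey_eq fin_num_measure.
apply: (@lt_le_trans _ _ (P [set w | npoints setT (X w) = 0%N])); last first.
  apply: le_measure; rewrite ?inE//; first exact: hm.
  move=> w /= w0 x y xX; exfalso.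
  by have := npoints_gt0 xX (I : setT x); rewrite w0.
rewrite (hpois setT [set 0%N])// (@poisson_prob_bool _ false).
  by rewrite lte_fin mulr1 expR_gt0.
by rewrite mulr_ge0 ?(ltW lam_gt0)// fine_ge0// vol_ge0.
Qed.

(** The numerator and the denominator of the density are limits of [occupation] and [partition_fun]
    times a common factor, so a bound valid for every mesh passes to the limit. *)
Lemma packing_density_ge (alpha : R) : (0 < vol S)%E ->
  (forall eta (F : fine_partition S eta), eta < rho ->
    alpha * fine (vol S) *
      partition_fun (@adj eta F) (@cell_mass eta F) lam [set: cell_index F]%SET <=
    occupation (@adj eta F) (@cell_mass eta F) lam [set: cell_index F]%SET) ->
  alpha <= packing_density P S X.
Proof.
move=> vS h.
have vS0 : 0 < fine (vol S).
  by rewrite fine_gt0// vS ltey_eq vol_bounded_fin.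
have [fA cA] := @integral_hard_core_cvg (fun n => n%:R) (fun=> ler0n _ _).
have [fB cB] := @integral_hard_core_cvg (fun=> 1) (fun=> ler01).
rewrite /packing_density /cond_expectation ler_pdivlMr// ler_pdivlMr ?hard_core_gt0//.
have -> : P (hard_core X) = (\int[P]_(w in hard_core X) 1%:E)%E.
  by rewrite integral_cst ?mul1e//; exact: measurable_hard_core.
have EA k := @integral_hard_core_approx _ (F_ k) (fun n => n%:R) (fun=> ler0n _ _).
have EB k := @integral_hard_core_approx _ (F_ k) (fun=> 1) (fun=> ler01).
move: cA cB; rewrite (funext EA) (funext EB) -(fineK fA) -(fineK fB).
move=> /fine_cvgP[_ cA] /fine_cvgP[_ cB].
set b := (X in X @ _ --> _) in cB.
have cB' : (alpha * fine (vol S) * b k) @[k --> \oo] -->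
    alpha * fine (vol S) * fine (\int[P]_(w in hard_core X) 1%:E)%E.
  by apply: cvgMr; exact: cB.
rewrite mulrAC mulrC mulrA [_ * alpha]mulrC; apply: (ler_cvg_to cB' cA).
apply: nearW => k /=; rewrite /b/= mulrCA ler_wpM2l ?expR_ge0//.
have := h _ (F_ k) (eta_sqr k); rewrite /partition_fun.
by under [in X in X -> _]eq_bigr do rewrite -[weight _ _ _]mul1r.
Qed.

End discretisation.

(** * Large sets have few close pairs *)

Section pair_density.
Context {R : realType} (d : nat).
Local Notation T := (d.-tuple R).
Local Notation bl := (@borel_lebesgue R d).
Local Notation r := (unit_volume_radius R d).
Local Notation rho := ((2 * r) ^+ 2).

Lemma expR1_le4 : expR 1 <= 4 :> R.
Proof.
have -> : (1 : R) = 1 / 2 + 1 / 2 by lra.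
have h : expR (1 / 2) <= 2 :> R.
  rewrite -[leRHS]invrK -[leLHS]invrK lef_pV2 ?posrE ?invr_gt0 ?expR_gt0//.
  by rewrite -expRN; apply: le_trans (expR_ge1Dx _); lra.
have h0 : 0 <= expR (1 / 2) :> R by exact: expR_ge0.
by rewrite expRD; apply: le_trans (ler_pM h0 h0 h h) _; lra.
Qed.

(* Up to a factor tending to 1 this is d / (2 r) ^ 2, the Gaussian parameter that
   minimises the bound below. *)
Let sg : R := pi * expR 1 / 2.

(** By the estimate of r_d, sg (m+1) rho <= (m+1) d exp (3 kappa), while pi / sg = 2 / e. Each of
    the d (m+1) factors is thus at most 2 exp (exp (3 kappa) - 1) <= 2 w; the rest is bounded by (4
    (m+1))^d. *)
Lemma complete_bipartite_const m (w kappa : R) : 1 <= w -> 0 < kappa -> kappa <= 1 ->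
  expR (3 * kappa) - 1 <= ln w -> 64 <= kappa ^+ 2 * d%:R ->
  expR (sg * m.+1%:R * rho) * Num.sqrt (pi / sg) ^+ (d * m.+1) *
  Num.sqrt (sg * m.+1%:R / pi) ^+ d * (Num.sqrt (pi / sg) ^+ (d * m.+1) * 2 ^+ d) <=
  ((2 * w) ^+ m.+1 * (4 * m.+1%:R)) ^+ d.
Proof.
move=> w1 k0 k1 kw kd; have p0 := pi_gt0 R.
have e0 : 0 < expR 1 :> R by exact: expR_gt0.
have e2 : 2 <= expR 1 :> R by apply: le_trans (expR_ge1Dx _); lra.
have rle := unit_volume_radius_le k0 k1 kd.
have sg0 : 0 < sg by rewrite /sg divr_gt0// mulr_gt0.
have pisg : pi / sg = 2 / expR 1.
  by rewrite /sg; move: (pi : R) p0 => p p0; field; rewrite !gt_eqF.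
have sgpi : sg * m.+1%:R / pi = expR 1 * m.+1%:R / 2.
  by rewrite /sg; move: (pi : R) p0 => p p0; field; rewrite !gt_eqF.
have m1 : 1 <= m.+1%:R :> R by rewrite ler1n.
have sq : Num.sqrt (sg * m.+1%:R / pi) <= 2 * m.+1%:R.
  rewrite sgpi; set x := (X in Num.sqrt X).
  have x1 : 1 <= x.
    rewrite /x ler_pdivlMr// mul1r; apply: le_trans e2 _; rewrite ler_peMr//; lra.
  apply: (@le_trans _ _ x).
    rewrite -[leRHS]ger0_norm; last lra.
    rewrite -sqrtr_sqr ler_sqrt ?sqr_ge0// expr2 ler_peMr//; lra.
  rewrite /x; have := expR1_le4 => e4.
  have : expR 1 * m.+1%:R <= 4 * m.+1%:R :> R by rewrite ler_wpM2r.
  lra.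
have ex : expR (sg * m.+1%:R * rho) <= (expR (expR (3 * kappa)) ^+ m.+1) ^+ d.
  rewrite -exprM -expRM_natl ler_expR natrM.
  have -> : sg * m.+1%:R * rho = 2 * pi * expR 1 * m.+1%:R * r ^+ 2.
    by rewrite /sg; lra.
  apply: (@le_trans _ _ (2 * pi * expR 1 * m.+1%:R *
      (d%:R / (2 * pi) * expR (3 * kappa - 1)))).
    by rewrite ler_wpM2l// !mulr_ge0// ltW.
  rewrite expRB; move: (pi : R) p0 (expR 1) (e0 : 0 < expR 1) => p p0 e e0'.
  rewrite le_eqVlt; apply/orP; left; apply/eqP.
  by field; rewrite !gt_eqF.
have key : expR (expR (3 * kappa)) * (2 / expR 1) <= 2 * w.
  rewrite mulrCA ler_wpM2l// -expRB.
  by rewrite -[leRHS]lnK ?posrE ?ler_expR//; lra.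
set q := Num.sqrt (pi / sg); set q' := Num.sqrt (sg * _ / pi) in sq *.
have q0 : 0 <= q by exact: sqrtr_ge0.
have q'0 : 0 <= q' by exact: sqrtr_ge0.
have qq : q ^+ (d * m.+1) * q ^+ (d * m.+1) = ((2 / expR 1) ^+ m.+1) ^+ d.
  rewrite -exprMn -expr2 sqr_sqrtr; last by rewrite divr_ge0// ltW.
  by rewrite pisg mulnC exprM.
have -> : expR (sg * m.+1%:R * rho) * q ^+ (d * m.+1) * q' ^+ d *
    (q ^+ (d * m.+1) * 2 ^+ d) =
    expR (sg * m.+1%:R * rho) * (q ^+ (d * m.+1) * q ^+ (d * m.+1)) *
    (q' ^+ d * 2 ^+ d) by ring.
rewrite qq [leRHS]exprMn.
have A0 : 0 <= 2 / expR 1 :> R by rewrite divr_ge0.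
apply: ler_pM.
- by rewrite mulr_ge0 ?expR_ge0 ?exprn_ge0.
- by rewrite mulr_ge0 ?exprn_ge0.
- apply: (@le_trans _ _ ((expR (expR (3 * kappa)) ^+ m.+1) ^+ d * ((2 / expR 1) ^+ m.+1) ^+ d)).
    by apply: ler_wpM2r => //; rewrite !exprn_ge0.
  rewrite -!exprMn lerXn2r ?nnegrE ?exprn_ge0 ?mulr_ge0 ?expR_ge0//; try lra.
  rewrite lerXn2r ?nnegrE ?mulr_ge0 ?expR_ge0//; lra.
- rewrite -exprMn lerXn2r ?nnegrE ?mulr_ge0//; lra.
Qed.

Variables (S : set T) (eta : R) (F : fine_partition S eta).
Hypotheses (d64 : (64 <= d)%N).
Local Notation V := (cell_index F).
Local Notation mu := (@cell_mass R d S eta F).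
Local Notation e := (@adj R d S eta F).
Hypothesis bS : eucl_bounded S.

Lemma cell_mass_le i : ((mu i)%:E <= bl (cell i))%E.
Proof.
rewrite /cell_mass fineK ?vol_setI_fin//; apply: vol_setI_le.
exact: measurable_cell.
Qed.

(** Cells adjacent to v lie in the ball of radius 2 r around any point of v, and this ball has
    volume 2^d. *)
Lemma sum_nbhd_le v (Q : {set V}) : Q \subset nbhd e v ->
  (\sum_(i in Q) bl (@cell _ _ _ _ F i) <= (2 ^+ d)%:E)%E.
Proof.
move=> Qv; have [r0 r1] := @unit_volume_radiusP R d d64.
have [x vx] := @cell_neq0 _ _ _ _ F v.
have <- : bl (eucl_ball x (2 * r)) = (2 ^+ d)%:E.
  by rewrite borel_lebesgue_ball// ?ltW// r1 mule1.
have := measure_bigcup_finType bl (mem Q) (@measurable_cell _ _ _ _ F)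
  (@trivIset_cell _ _ _ _ F).
move=> <-; apply: le_measure; rewrite ?inE.
- by apply: fin_bigcup_measurable => // i _; exact: measurable_cell.
- by apply: measurable_eucl_ball; rewrite mulr_ge0// ltW.
move=> y [i /= iQ yi]; rewrite eucl_ballE ?mulr_ge0 ?(ltW r0)//=.
have /fintype.subsetP/(_ i iQ) := Qv; rewrite inE => /asboolP h.
exact: ltW (h _ _ vx yi).
Qed.

Lemma mass_nbhd_le v (Q : {set V}) : Q \subset nbhd e v -> mass mu Q <= 2 ^+ d.
Proof.
move=> Qv; rewrite -lee_fin; apply: le_trans (sum_nbhd_le Qv).
by rewrite /mass -sumEFin; apply: lee_sum => i _; exact: cell_mass_le.
Qed.

(** With M = mass Q, Sidorenko's inequality bounds the (m+1)^2-th power of the left side by M^(2 m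
    (m+1)) ((2 w)^(m+1) 4 (m+1))^d. Since M^(2 (m+1)) >= (2 w^2)^(d (m+1)), dividing by M^(2
    (m+1)^2) leaves at most (4 (m+1) / w^(m+1))^d <= 2^(-d). *)
Lemma pair_density_le v (Q : {set V}) m (w kappa : R) :
  Q \subset nbhd e v -> 1 <= w -> 0 < kappa -> kappa <= 1 ->
  expR (3 * kappa) - 1 <= ln w -> 64 <= kappa ^+ 2 * d%:R ->
  8 * m.+1%:R <= w ^+ m.+1 -> (Num.sqrt 2 * w) ^+ d <= mass mu Q ->
  \sum_(u in Q) mu u * mass mu (Q :&: nbhd e u)%SET <=
    expR (- (ln 2 * d%:R / (m.+1 * m.+1)%:R)) * mass mu Q ^+ 2.
Proof.
move=> Qv w1 k0 k1 kw kd mw QM.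
set M := mass mu Q in QM *.
have w0 : 0 < w by lra.
have sqw0 : 0 < Num.sqrt 2 * w by rewrite mulr_gt0// sqrtr_gt0.
have M0 : 0 <= M by apply: le_trans QM; rewrite exprn_ge0// ltW.
(* Outside Q the mass is set to 0 and the cell to the empty set, so that all sums range over the
   whole vertex set. *)
pose a i := if i \in Q then mu i else 0.
pose A i := if i \in Q then @cell _ _ _ _ F i else set0.
have a0 i : 0 <= a i by rewrite /a; case: ifP => // _; exact: cell_mass_ge0.
have mA i : measurable (A i).
  by rewrite /A; case: ifP => // _; exact: measurable_cell.
have tA : trivIset setT A.
  move=> i j _ _; rewrite /A; case: ifP => _; last by rewrite set0I => -[].
  case: ifP => _; last by rewrite setI0 => -[].
  exact: (@trivIset_cell _ _ _ _ F i j Logic.I Logic.I).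
have eA i j x y : e i j -> A i x -> A j y -> sqdist x y <= rho.
  rewrite /A; case: ifP => _ //; case: ifP => _ // /asboolP h xi yj.
  exact: ltW (h _ _ xi yj).
have aA i : ((a i)%:E <= bl (A i))%E.
  by rewrite /a /A; case: ifP => _; [exact: cell_mass_le|rewrite measure0].
have AD : (\sum_i bl (A i) <= (2 ^+ d)%:E)%E.
  apply: le_trans (sum_nbhd_le Qv); rewrite [leRHS]big_mkcond/=; apply: lee_sum => i _.
  by rewrite /A; case: ifP => // _; rewrite measure0.
have sumE (f : V -> R) : \sum_i a i * f i = \sum_(i in Q) mu i * f i.
  rewrite [RHS]big_mkcond; apply: eq_bigr => i _; rewrite /a; case: ifP => // _.
  by rewrite mul0r.
have ME : \sum_i a i = M by rewrite /M /mass [RHS]big_mkcond.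
set lhs := (X in X <= _).
have lhsE : lhs = \sum_j a j * \sum_i a i * (e i j)%:R.
  rewrite sumE; apply: eq_bigr => u uQ; congr (_ * _); rewrite sumE /mass.
  rewrite big_mkcond [RHS]big_mkcond/=; apply: eq_bigr => i _; rewrite !inE.
  case: (i \in Q) => //=; rewrite adj_sym.
  by case: (e i u); rewrite ?mulr1 ?mulr0.
have lhs0 : 0 <= lhs.
  rewrite lhsE; apply: sumr_ge0 => j _; rewrite mulr_ge0//; apply: sumr_ge0 => i _.
  by rewrite mulr_ge0.
have sg0 : 0 < sg by rewrite divr_gt0// mulr_gt0 ?pi_gt0 ?expR_gt0.
have := sidorenko_complete_bipartite m a0 (fun i j => ler0n R (e i j)).
rewrite -lhsE ME => sido.
have := le_trans (@complete_bipartite_count R d V A e a rho (2 ^+ d) mA tA eA a0 aA AD m sg sg0)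
  (complete_bipartite_const m w1 k0 k1 kw kd).
set I0 := (X in X <= _) in sido * => hI.
have {}hI := le_trans sido (ler_wpM2l (exprn_ge0 _ M0) hI).
set p := expR _.
have p0 : 0 <= p by exact: expR_ge0.
have pm : p ^+ (m.+1 * m.+1) = 2^-1 ^+ d.
  rewrite /p -expRM_natl mulrN mulrC divfK ?pnatr_eq0 ?muln_eq0//.
  by rewrite -mulNr mulrC expRM_natl expRN lnK// posrE.
have : lhs ^+ (m.+1 * m.+1) <= (p * M ^+ 2) ^+ (m.+1 * m.+1).
  apply: (le_trans hI); rewrite [leRHS]exprMn pm -exprM.
  have -> : (2 * (m.+1 * m.+1))%N = ((m * m.+1).*2 + 2 * m.+1)%N.
    by rewrite -muln2 !mulSn !mulnS; ring.
  rewrite exprD mulrCA ler_wpM2l ?exprn_ge0//.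
  apply: (@le_trans _ _ (2^-1 ^+ d * ((Num.sqrt 2 * w) ^+ d) ^+ (2 * m.+1))); last first.
    by rewrite ler_wpM2l ?exprn_ge0 ?invr_ge0// lerXn2r ?nnegrE// exprn_ge0// ltW.
  rewrite exprAC (exprM _ 2) [(_ * w) ^+ 2]exprMn sqr_sqrtr// -[leRHS]exprMn.
  have w20 : 0 <= 2 * w ^+ 2 by rewrite mulr_ge0// exprn_ge0// ltW.
  have w10 : 0 <= 2 * w by rewrite mulr_ge0// ltW.
  rewrite lerXn2r ?nnegrE ?mulr_ge0 ?invr_ge0 ?exprn_ge0//.
  rewrite (expr2 w) [2 * (w * w)]mulrA [(2 * w * w) ^+ _]exprMn.
  have := ler_wpM2l (exprn_ge0 m.+1 w10) mw; lra.
by rewrite ler_pXn2r// nnegrE// mulr_ge0// exprn_ge0.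
Qed.

End pair_density.

(** * Elementary asymptotics, the density bound and the choice of constants *)

Section asymptotics.
Context {R : realType}.

Lemma natr_eventually_ge (x : R) : exists N : nat, forall n, (N <= n)%N -> x <= n%:R.
Proof.
exists (Num.truncn x).+1 => n Nn; apply: ltW.
by apply: lt_le_trans (truncnS_gt x) _; rewrite ler_nat.
Qed.

Lemma natr_mul_expR_small (c tau : R) : 0 < c -> 0 < tau ->
  exists N : nat, forall n, (N <= n)%N -> n%:R * expR (- (c * n%:R)) <= tau.
Proof.
move=> c0 t0; have [N hN] := natr_eventually_ge (4 / (c ^+ 2 * tau)).
exists N.+1 => n Nn; have {hN} := hN n (ltnW Nn).
have n0 : 0 < n%:R :> R by rewrite ltr0n (leq_ltn_trans _ Nn).
rewrite ler_pdivrMr; last by rewrite mulr_gt0// exprn_gt0.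
move=> hN; rewrite expRN ler_pdivrMr ?expR_gt0//.
have h : (c * n%:R / 2) ^+ 2 <= expR (c * n%:R).
  have -> : c * n%:R = c * n%:R / 2 + c * n%:R / 2 by lra.
  have x0 : 0 <= c * n%:R / 2 by rewrite divr_ge0// mulr_ge0// ltW.
  have hx : c * n%:R / 2 <= expR (c * n%:R / 2).
    by apply: le_trans (expR_ge1Dx _); lra.
  rewrite expRD; apply: le_trans (ler_pM x0 x0 hx hx); rewrite expr2; lra.
apply: le_trans (ler_wpM2l (ltW t0) h).
have := ler_wpM2l (ltW n0) hN; lra.
Qed.

End asymptotics.

(** [occupation_density] is applied at the smaller fugacity l, where l mass Q >= K >= 1 forces the
    mass that [pair_density_le] requires; [occupation_mono] then raises l to lam. *)
Lemma hard_core_density_bound (R : realType) (d : nat) (S : set (d.-tuple R))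
    (eta l lam K p w kappa : R) m (F : fine_partition S eta) :
  (64 <= d)%N -> eucl_bounded S -> lebesgue_measurable S ->
  eta < (2 * unit_volume_radius R d) ^+ 2 ->
  1 <= w -> 0 < kappa -> kappa <= 1 -> expR (3 * kappa) - 1 <= ln w ->
  64 <= kappa ^+ 2 * d%:R -> 8 * m.+1%:R <= w ^+ m.+1 ->
  p = expR (- (ln 2 * d%:R / (m.+1 * m.+1)%:R)) ->
  l = ((Num.sqrt 2 * w) ^+ d)^-1 -> l <= lam -> 1 <= K -> p * K <= 1 ->
  K * (1 - p * K) * fine (vol S) *
    partition_fun (@adj R d S eta F) (@cell_mass R d S eta F) lam [set: cell_index F]%SET <=
  (2 ^+ d + K * (1 - p * K) * expR K / l) *
    occupation (@adj R d S eta F) (@cell_mass R d S eta F) lam [set: cell_index F]%SET.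
Proof.
move=> d64 bS mS er w1 k0 k1 kw kd mw pE lE llam K1 pK.
have sw0 : 0 < Num.sqrt 2 * w by rewrite mulr_gt0 ?sqrtr_gt0//; lra.
have l0 : 0 < l by rewrite lE invr_gt0 exprn_gt0.
have K'0 : 0 <= K * (1 - p * K) by rewrite mulr_ge0//; lra.
have mu0 := @cell_mass_ge0 R d S eta F.
have esym := @adj_sym R d S eta F.
have erefl := @adj_refl R d S eta F er.
set mu := @cell_mass R d S eta F in mu0 *; set e := @adj R d S eta F in esym erefl *.
have massT : mass mu [set: cell_index F]%SET = fine (vol S).
  rewrite -(sum_vol_cells bS mS F) /mass; by apply: eq_bigl => i; rewrite inE.
have := @occupation_density R _ e mu erefl esym mu0 (2 ^+ d) l K
  (K * (1 - p * K)) l0 K'0.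
have hD v : mass mu (nbhd e v) <= 2 ^+ d by exact: (@mass_nbhd_le R d S eta F d64 bS v).
move=> /(_ hD); rewrite massT => hdens.
have hQ v (Q : {set cell_index F}) : Q \subset nbhd e v -> K <= l * mass mu Q ->
    K * (1 - p * K) * partition_fun e mu l Q <= occupation e mu l Q.
  move=> Qv KQ.
  have QM : (Num.sqrt 2 * w) ^+ d <= mass mu Q.
    have : 1 <= l * mass mu Q by lra.
    by rewrite lE ler_pdivlMl ?exprn_gt0// mulr1.
  have M0 : 0 < mass mu Q by apply: lt_le_trans QM; rewrite exprn_gt0.
  (* The bound x (1 - p x) with x = l mass Q is not monotone in l; lowering the fugacity to l' makes
     x equal to K, and [occupation_mono] leads back to l. *)
  pose l' := K / mass mu Q.
  have l'0 : 0 <= l' by rewrite divr_ge0// ?ltW//; lra.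
  have l'l : l' <= l by rewrite ler_pdivrMr.
  have l'M : l' * mass mu Q = K by rewrite divfK// gt_eqF.
  have := pair_density_le d64 bS Qv w1 k0 k1 kw kd mw QM; rewrite -pE => hp.
  have := occupation_lower_bound erefl esym mu0 l'0 hp; rewrite l'M => hl'.
  have Z'1 := partition_fun_ge1 e mu0 Q l'0.
  have Z1 := partition_fun_ge0 e mu0 Q (ltW l0).
  rewrite -(@ler_pM2r _ (partition_fun e mu l' Q)); last lra.
  apply: le_trans (occupation_mono e mu0 Q l'0 l'l).
  by rewrite mulrAC ler_wpM2r.
have h := hdens hQ.
have Zl1 := partition_fun_ge1 e mu0 [set: cell_index F]%SET (ltW l0).
have lam0 : 0 <= lam by lra.
have Zlam := partition_fun_ge0 e mu0 [set: cell_index F]%SET lam0.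
rewrite -(@ler_pM2r _ (partition_fun e mu l [set: cell_index F]%SET)); last lra.
apply: (@le_trans _ _ ((2 ^+ d + K * (1 - p * K) * expR K / l) *
  (occupation e mu l [set: cell_index F]%SET * partition_fun e mu lam [set: cell_index F]%SET))).
  by rewrite [leRHS]mulrA mulrAC ler_wpM2r.
rewrite -[leRHS]mulrA ler_wpM2l//.
  rewrite addr_ge0 ?exprn_ge0// divr_ge0 ?(ltW l0)// mulr_ge0 ?expR_ge0//.
exact: occupation_mono (ltW l0) llam.
Qed.

Theorem theorem3 (R : realType) (eps : R) (eps_gt0 : 0 < eps) :
  exists (delta : R) (d0 : nat), 0 < delta /\
    forall (d : nat) (lam : R) (S : set (d.-tuple R)),
      (d0 <= d)%N ->
      0 < lam ->
      ((Num.sqrt 2)^-1 - delta) ^+ d <= lam ->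
      eucl_bounded S -> lebesgue_measurable S -> (0 < vol S)%E ->
      forall (disp : measure_display) (T : measurableType disp)
        (P : probability T R) (X : T -> {fset d.-tuple R}),
        poisson_process P S lam X ->
        (ln (Num.sqrt 2) - eps) * d%:R * 2 ^- d <= packing_density P S X.
Proof.
pose L : R := ln (Num.sqrt 2).
have s2 : 0 < Num.sqrt 2 :> R by rewrite sqrtr_gt0.
have s2sq : Num.sqrt 2 ^+ 2 = 2 :> R by rewrite sqr_sqrtr.
have s21 : 1 < Num.sqrt 2 :> R.
  by rewrite -[ltLHS]sqrtr1 ltr_sqrt// ltr1n.
have L0 : 0 < L by rewrite ln_gt0.
have L1 : L <= 1.
  have : Num.sqrt 2 <= 2 :> R.
    rewrite -[leRHS]s2sq expr2 ler_peMr ?ltW//.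
  move=> h; have := @le_ln1Dx R (Num.sqrt 2 - 1).
  by rewrite addrCA subrr addr0 /L; move=> /(_ _); lra.
(* For eps >= L the claimed bound is at most 0, and the density is nonnegative. *)
have [epsL|Leps] := ltP eps L; last first.
  exists 1, 0%N; split=> // d lam S _ _ _ _ _ _ disp T P X _.
  apply: (@le_trans _ _ 0).
    rewrite -mulrA; apply: mulr_le0_ge0; first by rewrite subr_le0.
    by rewrite divr_ge0// exprn_ge0.
  apply: divr_ge0; last by apply: fine_ge0; exact: vol_ge0.
  apply: divr_ge0; apply: fine_ge0 => //.
  by apply: integral_ge0 => x _; rewrite lee_fin.
pose w := expR (eps / 8).
have w1 : 1 < w by rewrite -expR0 ltr_expR; lra.
have lnw : ln w = eps / 8 by rewrite expRK.
(* This gives exp (3 kappa) <= 1 + eps / 8 = 1 + ln w. *)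
pose kappa := Num.min 1 (ln (1 + eps / 8) / 3).
have k0 : 0 < kappa by rewrite lt_min ltr01 divr_gt0// ln_gt0; lra.
have k1 : kappa <= 1 by rewrite ge_min lexx.
have kw : expR (3 * kappa) - 1 <= ln w.
  rewrite lnw lerBlDl -[leRHS]lnK ?posrE; last lra.
  rewrite ler_expR -ler_pdivlMl// mulrC ge_min lexx orbT//.
have e80 : 0 < eps / 8 by lra.
have e40 : 0 < eps / 4 by lra.
have e18 : 0 < 1 / 8 :> R by lra.
(* The bound tau = 1/8 is the condition 8 (m+1) <= w^(m+1) at n = m+1. *)
have [m hm] := natr_mul_expR_small e80 e18.
have mw : 8 * m.+1%:R <= w ^+ m.+1.
  have := hm _ (leqnSn m); rewrite expRN ler_pdivrMr ?expR_gt0//.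
  by rewrite /w -expRM_natl [_ * (eps / 8)]mulrC; lra.
pose c := ln 2 / (m.+1 * m.+1)%:R : R.
have c0 : 0 < c by rewrite divr_gt0// ?ln_gt0 ?ltr1n// ltr0n.
have [d1 hd1] := natr_mul_expR_small e80 e40.
have [d2 hd2] := natr_mul_expR_small c0 e40.
have [d3 hd3] := natr_eventually_ge (64 / kappa ^+ 2).
have [d4 hd4] := natr_eventually_ge (1 / (L - eps / 4)).
(* This delta turns ((sqrt 2)^-1 - delta)^d into l = (sqrt 2 w)^(-d). *)
exists ((Num.sqrt 2)^-1 - (Num.sqrt 2 * w)^-1), (64 + d1 + d2 + d3 + d4)%N; split.
  rewrite subr_gt0 ltf_pV2 ?posrE ?mulr_gt0//; last lra.
  by rewrite ltr_pMr.
move=> d lam S hd lam0 hlam bS mS vS disp T P X HX.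
have d64 : (64 <= d)%N by apply: leq_trans hd; rewrite -!addnA leq_addr.
have {}hd1 : d%:R * expR (- (eps / 8 * d%:R)) <= eps / 4.
  by apply: hd1; apply: leq_trans hd; rewrite -!addnA addnCA leq_addr.
have {}hd2 : d%:R * expR (- (c * d%:R)) <= eps / 4.
  by apply: hd2; apply: leq_trans hd; rewrite -addnA addnAC leq_addl.
have {}hd3 : 64 / kappa ^+ 2 <= d%:R.
  by apply: hd3; apply: leq_trans hd; rewrite addnAC leq_addl.
have {}hd4 : 1 / (L - eps / 4) <= d%:R.
  by apply: hd4; apply: leq_trans hd; rewrite leq_addl.
set p := expR (- (c * d%:R)) in hd2; set E := expR _ in hd1.
have n0 : 0 < d%:R :> R by rewrite ltr0n (leq_trans _ d64).
have kd : 64 <= kappa ^+ 2 * d%:R by rewrite -ler_pdivrMl ?exprn_gt0// mulrC.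
pose K := (L - eps / 4) * d%:R.
have K1 : 1 <= K by rewrite -ler_pdivrMl; [rewrite mulrC|lra].
have Kd : K <= d%:R by rewrite ler_piMl ?(ltW n0)//; lra.
have p0 : 0 <= p by exact: expR_ge0.
have E0 : 0 <= E by exact: expR_ge0.
have pK : p * K <= eps / 4.
  by apply: le_trans (ler_wpM2l p0 Kd) _; rewrite mulrC.
have pK1 : p * K <= 1 by lra.
have pK0 : 0 <= p * K by rewrite mulr_ge0//; lra.
pose l := ((Num.sqrt 2 * w) ^+ d)^-1.
have llam : l <= lam by move: hlam; rewrite subKr exprVn.
have pE : p = expR (- (ln 2 * d%:R / (m.+1 * m.+1)%:R)) by rewrite mulrAC.
have [r0 _] := @unit_volume_radiusP R d d64.
apply: (packing_density_ge bS mS lam0 HX r0 vS) => eta F er.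
have := @hard_core_density_bound R d S eta l lam K p w kappa m F d64 bS mS er
  (ltW w1) k0 k1 kw kd mw pE erefl llam K1 pK1.
set K' := K * (1 - p * K) => h.
(* exp K = (sqrt 2)^d exp (- eps d / 4) and 1 / l = (sqrt 2)^d exp (eps d / 8), so the product is
   2^d exp (- eps d / 8): the margin eps / 4 in K outweighs the factor w. *)
have EK : expR K / l = 2 ^+ d * E.
  rewrite /l invrK /K mulrBl expRB mulrC [L * _]mulrC expRM_natl lnK ?posrE//.
  rewrite exprMn -expRM_natl /E expRN.
  have -> : eps / 4 * d%:R = d%:R * (eps / 8) + d%:R * (eps / 8) by lra.
  have -> : 2 ^+ d = Num.sqrt 2 ^+ d * Num.sqrt 2 ^+ d :> R.
    by rewrite -exprMn -expr2 s2sq.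
  rewrite [eps / 8 * _]mulrC expRD.
  by field; rewrite gt_eqF ?expR_gt0.
have K'0 : 0 <= K' by rewrite mulr_ge0; lra.
have K'K : K' <= K by rewrite /K' ler_piMr; lra.
have K'E : K' * E <= eps / 4.
  by apply: le_trans hd1; rewrite ler_wpM2r//; lra.
have K'l : (L - eps / 4) * (1 - eps / 4) * d%:R <= K'.
  rewrite /K' mulrAC -/K ler_wpM2l//; lra.
move: h; rewrite -[K' * expR K / l]mulrA EK => h.
set G := _ + _ in h.
have t0 : 0 < 2 ^+ d :> R by rewrite exprn_gt0.
have GE : G = 2 ^+ d * (1 + K' * E) by rewrite /G; ring.
have G0 : 0 < G.
  by rewrite GE mulr_gt0// ltr_wpDr// mulr_ge0.
(* This reduces to (L - eps) (1 + eps / 4) <= (L - eps / 4) (1 - eps / 4), which follows from L <=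
   1. *)
have aG : (L - eps) * d%:R * 2 ^- d * G <= K'.
  rewrite GE mulrA mulfVK ?gt_eqF//.
  apply: (@le_trans _ _ ((L - eps) * d%:R * (1 + eps / 4))).
    rewrite ler_wpM2l//; last lra.
    by rewrite mulr_ge0 ?(ltW n0)//; lra.
  apply: le_trans K'l; rewrite mulrAC ler_wpM2r ?(ltW n0)//.
  have : L * eps <= eps by rewrite ler_piMl// ltW.
  have : 0 <= eps * eps by rewrite mulr_ge0 ?ltW.
  lra.
have v0 : 0 <= fine (vol S) by apply: fine_ge0; exact: vol_ge0.
have Z0 := partition_fun_ge0 (@adj R d S eta F) (@cell_mass_ge0 R d S eta F)
  [set: cell_index F]%SET (ltW lam0).
rewrite -(ler_pM2l G0); apply: le_trans h.
rewrite mulrA [_ * (_ * _)]mulrA ler_wpM2r// ler_wpM2r//.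
by rewrite mulrC.
Qed.
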